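(* Let $\{P_0,P_1\}$ be a symmetric Clifford system on $\mathbb{R}^{8}$, and let $$M_+^5=\{x\in S^{7}:\ \langle P_0x,x\rangle=\langle P_1x,x\rangle=0\}.$$ Let $S^1\times M_+^5$ carry the product metric and the complex structure $J$ defined at $(a,x)$ by $$J\varepsilon=\eta,\qquad J\eta=-\varepsilon,\qquad JX=P_0P_1X\ \text{ for } X\in V,$$ where $\varepsilon=\sqrt{-1}\,a\in T_aS^1$, $\eta=P_0P_1x\in T_xM_+^5$, and $V$ is the orthogonal complement of $\mathrm{Span}\{\eta\}$ in $T_xM_+^5$. Then the Hermitian manifold $S^1\times M_+^5$ admits a (global) orthonormal $U$-frame. Thus the first Chern class of $J$ vanishes.
   Context: A symmetric Clifford system $\{P_0,P_1\}$ on $\mathbb{R}^{2l}$ is a pair of real symmetric $2l\times 2l$ matrices with $P_iP_j+P_jP_i=2\delta_{ij}I_{2l}$; here $l=4$. $S^7$ is the unit sphere in $\mathbb{R}^8$ and $S^1$ is the unit circle in $\mathbb{C}$. $M_+^5$ is a smooth $5$-dimensional submanifold of $S^7$, diffeomorphic to $S^3\times S^2$ (the focal submanifold of OT-FKM type with $(m_1,m_2)=(1,2)$), with the metric induced from $S^7$; the product metric is that of the standard metric on $S^1$ and this one. One has $P_0P_1V\subset V$; $J$ is integrable and compatible with the product metric, so $S^1\times M_+^5$ is a Hermitian manifold. On an almost complex manifold $(M^{2n},J)$ a $U$-frame is a frame of vector fields $(e_1,\dots,e_{2n})$ with $J(e_1,\dots,e_{2n})=(e_1,\dots,e_{2n})J_0$,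 where $J_0=\begin{pmatrix}0&-I_n\\ I_n&0\end{pmatrix}$, i.e. $Je_j=e_{n+j}$ and $Je_{n+j}=-e_j$ for $1\le j\le n$. Here $n=3$, and the frame is required to be smooth, defined on all of $S^1\times M_+^5$, and orthonormal for the product metric. The first Chern class of $J$ is the first Chern class of the complex vector bundle $(T(S^1\times M_+^5),J)$. *)

(* Defs.v *)
From HB Require Import structures.
From mathcomp Require Import all_boot all_order all_algebra.
From mathcomp Require Import all_classical all_reals all_analysis.
From mathcomp.real_closed Require Import complex.

Set Implicit Arguments.
Unset Strict Implicit.
Unset Printing Implicit Defensive.

Import Order.TTheory GRing.Theory Num.Theory.
Import numFieldNormedType.Exports.

Local Open Scope classical_set_scope.
Local Open Scope ring_scope.
Local Open Scope complex_scope.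

Section Smooth.
Context {R : realType}.

(* On finite-dimensional spaces and for open O this is the usual class C^k:
   all iterated directional derivatives up to order k exist and are
   continuous on O. *)
Fixpoint Ck_on (V W : normedModType R) (k : nat) (O : set V) (f : V -> W)
    : Prop :=
  if k is k'.+1 then
    (forall x, O x -> differentiable f x) /\
    (forall v : V, Ck_on k' O (fun x => 'D_v f x))
  else forall x, O x -> {for x, continuous f}.

Definition smooth_on (V W : normedModType R) (O : set V) (f : V -> W) : Prop :=
  forall k, Ck_on k O f.

(* Smoothness of a map defined on a subset S of a vector space: around each
   point of S it is the restriction of a smooth map on an open set.  Values
   of f outside S are irrelevant. *)
Definition smooth_map (V W : normedModType R) (S : set V) (f : V -> W) : Prop :=
  forall p, S p -> exists (O : set V) (g : V -> W),
    [/\ open O, O p, smooth_on O g & forall q, O q -> S q -> g q = f q].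

(* Velocities at p of smooth curves in S. *)
Definition tangent_space (V : normedModType R) (S : set V) (p : V) : set V :=
  [set v | exists (d : R) (gamma : R -> V),
    [/\ 0 < d,
        smooth_on (`]- d, d[%classic : set R) gamma,
        (forall t, - d < t < d -> S (gamma t)),
        gamma 0 = p
      & derive1 gamma 0 = v]].

End Smooth.

(* Cech cohomology of a subspace S of B with integer coefficients, computed
   with the open covers of S indexed by the points of S, the set U x being a
   neighbourhood of x.  Every open cover is refined by one of these, and they
   are directed by inclusion without any choice of refinement maps.  Open
   subsets of S are represented by open subsets of B intersected with S, and
   values of cochains outside S and the relevant overlaps are irrelevant. *)
Section Cech.
Context (B : topologicalType) (S : set B).

Record point_cover := PointCover {
  nbhd :> B -> set B;
  nbhd_open : forall x, S x -> open (nbhd x);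
  nbhd_mem : forall x, S x -> nbhd x x }.

Definition locally_constant (D : set B) (c : B -> int) : Prop :=
  forall q, D q -> \forall q' \near within D (nbhs q), c q' = c q.

Record cech_cocycle2 := CechCocycle2 {
  cocover : point_cover;
  coval : B -> B -> B -> B -> int;
  coval_locally_constant : forall x y z, S x -> S y -> S z ->
    locally_constant (cocover x `&` cocover y `&` cocover z `&` S)
      (coval x y z);
  coval_closed : forall x y z w, S x -> S y -> S z -> S w ->
    forall q, (cocover x `&` cocover y `&` cocover z `&` cocover w `&` S) q ->
    coval y z w q - coval x z w q + coval x y w q - coval x y z q = 0 }.

(* Equality in the direct limit over all point-indexed covers. *)
Definition cohomologous (c c' : cech_cocycle2) : Prop :=
  exists (W : point_cover) (b : B -> B -> B -> int),
  [/\ forall x, S x -> W x `<=` cocover c x `&` cocover c' x,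
      forall x y, S x -> S y -> locally_constant (W x `&` W y `&` S) (b x y)
    & forall x y z, S x -> S y -> S z ->
      forall q, (W x `&` W y `&` W z `&` S) q ->
      coval c x y z q - coval c' x y z q = b y z q - b x z q + b x y q].

(* Elements of H^2(S; Z) are equivalence classes of cocycles for
   cohomologous, as sets of cocycles. *)
Definition cech_class (c : cech_cocycle2) : set cech_cocycle2 :=
  [set c' | cohomologous c c'].

Definition trivial_cover : point_cover :=
  @PointCover (fun=> setT) (fun _ _ => openT) (fun _ _ => I).

Fact zero_cocycle_locally_constant x y z : S x -> S y -> S z ->
  locally_constant
    (trivial_cover x `&` trivial_cover y `&` trivial_cover z `&` S) (fun=> 0).
Proof. by move=> _ _ _ q _; exact: nearW. Qed.

Fact zero_cocycle_closed x y z w : S x -> S y -> S z -> S w ->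
  forall q, (trivial_cover x `&` trivial_cover y `&` trivial_cover z
             `&` trivial_cover w `&` S) q ->
  0 - 0 + 0 - 0 = 0 :> int.
Proof. by []. Qed.

Definition zero_cocycle2 : cech_cocycle2 :=
  @CechCocycle2 trivial_cover (fun _ _ _ _ => 0)
    zero_cocycle_locally_constant zero_cocycle_closed.

Definition H2_zero : set cech_cocycle2 := cech_class zero_cocycle2.

End Cech.

Arguments H2_zero {B} S.

Section FirstChernClass.
Context {R : realType}.

Definition cexp (z : R[i]) : R[i] :=
  (expR (complex.Re z))%:C * (cos (complex.Im z) +i* sin (complex.Im z)).

Definition continuousC_on (B : topologicalType) (D : set B) (f : B -> R[i])
    : Prop :=
  {within D, continuous (fun q => complex.Re (f q))} /\
  {within D, continuous (fun q => complex.Im (f q))}.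

(* A complex vector bundle of rank n over the subspace S of B, given as a
   family T of real subspaces of a fixed normed space E, the imaginary unit
   acting on the fibre T q by J q. *)
Context (B : topologicalType) (S : set B) (E : normedModType R).
Context (n : nat) (T : B -> set E) (J : B -> E -> E).

Definition complex_scale (q : B) (z : R[i]) (v : E) : E :=
  complex.Re z *: v + complex.Im z *: J q v.

Definition complex_frame_on (D : set B) (s : 'I_n -> B -> E) : Prop :=
  [/\ forall k, {within D, continuous (s k)},
      forall k q, D q -> T q (s k q)
    & forall q v, D q -> T q v ->
        exists! z : 'cV[R[i]]_n, v = \sum_k complex_scale q (z k 0) (s k q)].

(* c_1 of a complex vector bundle is c_1 of its determinant line bundle, that
   is the image of the cocycle of determinants det g_xy of its transition
   matrices under the connecting map H^1(S; C^* ) -> H^2(S; Z) of the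
   exponential sequence 0 -> Z -> C -> C^* -> 0, the second map being
   f |-> exp (2 pi i f) on continuous functions.  Here c is a cocycle that
   represents c_1, computed on a cover on which the bundle has local frames
   s x and on whose overlaps det g_xy has a logarithm. *)
Definition chern_cocycle (c : cech_cocycle2 S) : Prop :=
  exists (s : B -> 'I_n -> B -> E) (g : B -> B -> B -> 'M[R[i]]_n)
         (f : B -> B -> B -> R[i]),
  let U := cocover c in
  [/\ forall x, S x -> complex_frame_on (U x `&` S) (s x),
      forall x y, S x -> S y -> forall q, (U x `&` U y `&` S) q ->
        forall j, s y j q =
          \sum_k complex_scale q (g x y q k j) (s x k q),
      forall x y, S x -> S y -> continuousC_on (U x `&` U y `&` S) (f x y),
      forall x y, S x -> S y -> forall q, (U x `&` U y `&` S) q ->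
        cexp ((0 +i* (2 * pi)) * f x y q) = \det (g x y q)
    & forall x y z, S x -> S y -> S z ->
        forall q, (U x `&` U y `&` U z `&` S) q ->
        (coval c x y z q)%:~R = f y z q - f x z q + f x y q].

Definition first_chern_class : set (cech_cocycle2 S) :=
  [set c | exists2 d, chern_cocycle d & cohomologous d c].

End FirstChernClass.

Arguments first_chern_class {R B} S {E} n T J.

Section FocalSubmanifold.
Context {R : realType}.

Definition dot n (u v : 'cV[R]_n) : R := \sum_i u i 0 * v i 0.

Definition symmetric_clifford_system m n (P : 'I_m -> 'M[R]_n) : Prop :=
  (forall i, (P i)^T = P i) /\
  (forall i j, P i *m P j + P j *m P i = (2 * (i == j)%:R)%:M).

(* C x R^8, a complex number being given by its real and imaginary parts. *)
Definition ambient : normedModType R := (R * R * 'cV[R]_8)%type.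

Definition ambient_dot (v w : ambient) : R :=
  v.1.1 * w.1.1 + v.1.2 * w.1.2 + dot v.2 w.2.

Definition circle : set (R * R)%type :=
  [set a | a.1 ^+ 2 + a.2 ^+ 2 = 1].

Variable P : 'I_2 -> 'M[R]_8.

Definition focal : set 'cV[R]_8 :=
  [set x | [/\ dot x x = 1, dot (P 0 *m x) x = 0 & dot (P 1 *m x) x = 0]].

Definition circle_focal : set ambient := circle `*` focal.

(* Multiplication by the imaginary unit: (x + i y) |-> (- y + i x). *)
Definition eps (a : R * R) : R * R := (- a.2, a.1).

Definition eta (x : 'cV[R]_8) : 'cV[R]_8 := P 0 *m P 1 *m x.

Definition eta_complement (x : 'cV[R]_8) : set 'cV[R]_8 :=
  [set X | tangent_space focal x X /\ dot X (eta x) = 0].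

(* These conditions determine J p on the tangent space at each p = (a, x);
   the values of J p elsewhere are irrelevant. *)
Definition product_complex_structure (J : ambient -> ambient -> ambient)
    : Prop :=
  forall (a : R * R) (x : 'cV[R]_8), circle_focal (a, x) ->
  let p : ambient := (a, x) in
  [/\ forall (c : R) (v w : ambient),
        tangent_space circle_focal p v -> tangent_space circle_focal p w ->
        J p (c *: v + w) = c *: J p v + J p w,
      J p (eps a, 0) = (0, eta x),
      J p (0, eta x) = (- eps a, 0)
    & forall X, eta_complement x X -> J p (0, X) = (0, P 0 *m P 1 *m X)].

(* Global smooth frames of the tangent bundle. *)
Definition tangent_frame n (e : 'I_n -> ambient -> ambient) : Prop :=
  [/\ forall i, smooth_map circle_focal (e i),
      forall i p, circle_focal p -> tangent_space circle_focal p (e i p)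
    & forall p v, circle_focal p -> tangent_space circle_focal p v ->
        exists! c : 'cV[R]_n, v = \sum_i c i 0 *: e i p].

Definition J0 n : 'M[R]_(n + n) := block_mx 0 (- 1%:M) 1%:M 0.

Definition U_frame n (J : ambient -> ambient -> ambient)
    (e : 'I_(n + n) -> ambient -> ambient) : Prop :=
  tangent_frame e /\
  forall p j, circle_focal p -> J p (e j p) = \sum_i J0 n i j *: e i p.

Definition orthonormal_frame n (e : 'I_n -> ambient -> ambient) : Prop :=
  forall p i j, circle_focal p -> ambient_dot (e i p) (e j p) = (i == j)%:R.

End FocalSubmanifold.

Arguments U_frame {R} P {n} J e.

(* Main.v *)
(* P_0 P_1 is a complex structure on R^8, and P_1 exchanges the eigenspaces of
   P_0.  Identifying the (+1)-eigenspace with the quaternions H, a point of M is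
   x = (a, b) / sqrt 2 with a, b orthonormal in H, that is b = a q with q a unit
   imaginary quaternion, and V is a times the complexification of q^perp in
   Im H = R^3.  This complexified pull-back of TS^2 is trivial: since the real
   vector q never equals i e_3 in C^3, there is a unitary reflection of C^3
   taking i e_3 to q, rational in q, and it maps e_1, e_2 to a global unitary
   frame of V.  Together with eps it gives the U-frame.

   The tangent spaces are exactly the expected linear spaces because every
   candidate velocity is that of a product of rotations generated by P_0 P_1 and
   by the left and right quaternion multiplications.

   A global complex frame makes the transition determinants of any other system
   of local frames the coboundary of the determinants of these frames with
   respect to the global one; local logarithms of the latter turn a cocycle
   representing c_1 into the coboundary of an integral cochain. *)

From HB Require Import structures.
From mathcomp Require Import all_boot all_order all_algebra.
From mathcomp Require Import all_classical all_reals all_analysis.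
From mathcomp.real_closed Require Import complex.
From mathcomp Require Import ring lra.
Require Import Defs.

Set Implicit Arguments.
Unset Strict Implicit.
Unset Printing Implicit Defensive.

Import Order.TTheory GRing.Theory Num.Theory.
Import numFieldNormedType.Exports.

Local Open Scope classical_set_scope.
Local Open Scope ring_scope.
Local Open Scope complex_scope.

(** * Smooth maps *)

Section SmoothCalculus.
Context {R : realType}.
Implicit Types U V W : normedModType R.

(** All curves and fields constructed below are smooth on a whole vector space, so the calculus is
    developed on [setT] only; [smooth_onS] restricts to smaller sets. *)
Local Notation smooth := (smooth_on setT).

Lemma Ck_onW V W k (f : V -> W) : Ck_on k.+1 setT f -> Ck_on k setT f.
Proof.
elim: k f => [|k IH] f [df Df].
  by move=> x _; apply: differentiable_continuous; exact: (df _ I).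
by split=> // v; apply: IH; exact: Df.
Qed.

Lemma smooth_differentiable V W (f : V -> W) x : smooth f -> differentiable f x.
Proof. by move=> /(_ 1%N)[/(_ x I)]. Qed.

Lemma smooth_continuous V W (f : V -> W) : smooth f -> continuous f.
Proof. by move=> /(_ 0%N) + x => /(_ x I). Qed.

Lemma smooth_onS V W (A : set V) (f : V -> W) : smooth f -> smooth_on A f.
Proof.
move=> + k => /(_ k).
elim: k f => [|k IH] f /=; first by move=> + x _; exact.
by move=> [df Df]; split=> [x _|v]; [exact: df | exact: IH].
Qed.

Lemma Ck_cst V W k (w : W) : Ck_on k setT (fun _ : V => w).
Proof.
elim: k w => [|k IH] w; first by move=> x _; exact: cvg_cst.
split=> [x _|v]; first exact: differentiable_cst.
rewrite [X in Ck_on _ _ X](_ : _ = fun=> 0); first exact: IH.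
by apply/funext => x; exact: derive_cst.
Qed.

Lemma smooth_cst V W (w : W) : smooth (fun _ : V => w).
Proof. by move=> k; exact: Ck_cst. Qed.

Lemma Ck_add V W k (f g : V -> W) :
  Ck_on k setT f -> Ck_on k setT g -> Ck_on k setT (fun x => f x + g x).
Proof.
elim: k f g => [|k IH] f g /=.
  by move=> cf cg x Tx; apply: cvgD; [exact: cf | exact: cg].
move=> [df Df] [dg Dg]; split=> [x Tx|v].
  by apply: differentiableD; [exact: df | exact: dg].
rewrite [X in Ck_on _ _ X](_ : _ = fun x => 'D_v f x + 'D_v g x).
  exact: IH.
apply/funext => x; apply: deriveD; apply: diff_derivable.
  exact: (df _ I).
exact: dg.
Qed.

Lemma smooth_add V W (f g : V -> W) :
  smooth f -> smooth g -> smooth (fun x => f x + g x).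
Proof. by move=> sf sg k; exact: Ck_add. Qed.

Lemma smooth_sum V W (I : Type) (r : seq I) (f : I -> V -> W) :
  (forall i, smooth (f i)) -> smooth (fun x => \sum_(i <- r) f i x).
Proof.
move=> sf; elim: r => [|i r IH].
  rewrite [X in smooth_on _ X](_ : _ = fun=> 0); first exact: smooth_cst.
  by apply/funext => x; rewrite big_nil.
rewrite [X in smooth_on _ X](_ : _ = fun x => f i x + \sum_(j <- r) f j x).
  exact: smooth_add.
by apply/funext => x; rewrite big_cons.
Qed.

Lemma derive_linear_comp U V W (L : {linear V -> W}) (f : U -> V) x v :
  continuous L -> differentiable f x -> 'D_v (fun y => L (f y)) x = L ('D_v f x).
Proof.
move=> cL df; have dL : differentiable L (f x) by exact: linear_differentiable.
rewrite deriveE; last exact: (differentiable_comp df dL).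
by rewrite (diff_comp df dL) /= diff_lin // deriveE.
Qed.

Lemma smooth_linear_comp U V W (L : {linear V -> W}) (f : U -> V) :
  continuous L -> smooth f -> smooth (fun x => L (f x)).
Proof.
move=> cL + k => /(_ k); elim: k f => [|k IH] f /=.
  by move=> cf x Tx; apply: continuous_comp; [exact: cf | exact: cL].
move=> [df Df]; split=> [x Tx|v].
  by apply: differentiable_comp; [exact: df | exact: linear_differentiable].
rewrite [X in Ck_on _ _ X](_ : _ = fun x => L ('D_v f x)); first exact: IH.
by apply/funext => x; apply: derive_linear_comp => //; exact: (df _ I).
Qed.

(** The derivative of [f \o L] along [v] is that of [f] along [L v], again composed with [L], so the
    induction closes without a general chain rule for class C^k. *)
Lemma smooth_comp_linear U V W (L : {linear U -> V}) (f : V -> W) :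
  continuous L -> smooth f -> smooth (fun x => f (L x)).
Proof.
move=> cL + k => /(_ k); elim: k f => [|k IH] f /=.
  by move=> cf x Tx; apply: continuous_comp; [exact: cL | exact: cf].
move=> [df Df]; have dL x : differentiable L x by exact: linear_differentiable.
have dfL x : differentiable (fun y => f (L y)) x.
  by apply: differentiable_comp => //; exact: (df _ I).
split=> [x _ //|v].
rewrite [X in Ck_on _ _ X](_ : _ = fun x => 'D_(L v) f (L x)).
  exact: (IH _ (Df _)).
apply/funext => x; have dfx := df (L x) I.
by rewrite !deriveE // (diff_comp (dL x) dfx) /= diff_lin.
Qed.

Lemma smooth_id V : smooth (@id V).
Proof.
case=> [|k]; first by move=> x _; exact: cvg_id.
split=> [x _|v]; first exact: ex_diff.
rewrite [X in Ck_on _ _ X](_ : _ = fun=> v); first exact: Ck_cst.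
by apply/funext => x; exact: derive_id.
Qed.

Lemma scale_is_bilinear W :
  bilinear_for
    (GRing.Scale.Law.clone _ _ *:%R _) (GRing.Scale.Law.clone _ _ *:%R _)
    (fun (a : R) (w : W) => a *: w).
Proof.
split=> [w|a] b x y /=; first by rewrite scalerDl scalerA.
by rewrite scalerDr !scalerA mulrC.
Qed.

(** The product rule, read off from the differential of the continuous bilinear map
    [(a, w) |-> a *: w]. *)
Lemma is_diff_scale V W (f : V -> R) (g : V -> W) x :
  differentiable f x -> differentiable g x ->
  differentiable (fun y => f y *: g y) x /\
  forall v, 'D_v (fun y => f y *: g y) x = 'D_v f x *: g x + f x *: 'D_v g x.
Proof.
move=> df dg.
pose bM := bilinear_isBilinear.Build R R W W _ _ _ (@scale_is_bilinear W).
pose b : {bilinear R -> W -> W} := HB.pack (fun (a : R) (w : W) => a *: w) bM.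
have cb : continuous (fun p : R * W => b p.1 p.2) by exact: scale_continuous.
have dfg := differentiable_pair df dg.
have db := @differentiable_bilin _ _ _ _ b (f x, g x) cb.
have dc : differentiable (fun y => f y *: g y) x.
  exact: (differentiable_comp dfg db).
split=> // v.
rewrite deriveE //.
have -> : (fun y => f y *: g y) = (fun q => b q.1 q.2) \o (fun y => (f y, g y)).
  by [].
rewrite (diff_comp dfg db) /comp (diff_bilin _ cb) diff_pair //=.
by rewrite !deriveE // addrC.
Qed.

Lemma Ck_scale V W k (f : V -> R) (g : V -> W) :
  Ck_on k setT f -> Ck_on k setT g -> Ck_on k setT (fun x => f x *: g x).
Proof.
elim: k f g => [|k IH] f g.
  by move=> cf cg x Tx; apply: cvgZ; [exact: cf | exact: cg].
move=> Cf Cg; have [df Df] := Cf; have [dg Dg] := Cg.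
have dfg x := is_diff_scale (df x I) (dg x I).
split=> [x _|v]; first by have [] := dfg x.
rewrite [X in Ck_on _ _ X](_ : _ = fun x => 'D_v f x *: g x + f x *: 'D_v g x).
  by apply: Ck_add; apply: IH;
    [exact: Df | exact: Ck_onW | exact: Ck_onW | exact: Dg].
by apply/funext => x; have [_] := dfg x.
Qed.

Lemma smooth_scale V W (f : V -> R) (g : V -> W) :
  smooth f -> smooth g -> smooth (fun x => f x *: g x).
Proof. by move=> sf sg k; exact: Ck_scale. Qed.

Lemma smooth_mul V (f g : V -> R) :
  smooth f -> smooth g -> smooth (fun x => f x * g x).
Proof. exact: smooth_scale. Qed.

Lemma smooth_opp V W (f : V -> W) : smooth f -> smooth (fun x => - f x).
Proof.
move=> sf; rewrite [X in smooth_on _ X](_ : _ = fun x => -1 *: f x).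
  by apply: smooth_scale => //; exact: smooth_cst.
by apply/funext => x; rewrite scaleN1r.
Qed.

Lemma smooth_sub V W (f g : V -> W) :
  smooth f -> smooth g -> smooth (fun x => f x - g x).
Proof. by move=> sf sg; apply: smooth_add => //; exact: smooth_opp. Qed.

(** The derivative [- f^-2 f'] involves the inverse itself only to the previous order, which the
    induction provides. *)
Lemma smooth_inv V (f : V -> R) :
  (forall x, f x != 0) -> smooth f -> smooth (fun x => (f x)^-1).
Proof.
move=> f0 + k => /(_ k); elim: k => [|k IH] Cf.
  by move=> x Tx; apply: cvgV => //; exact: Cf.
have [df Df] := Cf.
split=> [x Tx|v]; first by apply: differentiableV => //; exact: (df _ I).
rewrite [X in Ck_on _ _ X]
  (_ : _ = fun x => (-1 * ((f x)^-1 * (f x)^-1)) * 'D_v f x).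
  have Ci := IH (Ck_onW Cf); apply: Ck_scale; last exact: Df.
  by apply: Ck_scale; [exact: Ck_cst | exact: Ck_scale].
apply/funext => x; rewrite deriveV //; last exact/diff_derivable/df.
by rewrite -exprVn expr2 mulN1r.
Qed.

Lemma derive_pair U V W (f : U -> V) (g : U -> W) x v :
  differentiable f x -> differentiable g x ->
  'D_v (fun y => (f y, g y)) x = ('D_v f x, 'D_v g x).
Proof.
move=> df dg; have dfg := differentiable_pair df dg.
by rewrite deriveE // diff_pair // !deriveE.
Qed.

Lemma smooth_pair U V W (f : U -> V) (g : U -> W) :
  smooth f -> smooth g -> smooth (fun x => (f x, g x)).
Proof.
move=> + + k => /(_ k) + /(_ k); elim: k f g => [|k IH] f g.
  by move=> cf cg x Tx; apply: cvg_pair; [exact: cf | exact: cg].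
move=> [df Df] [dg Dg].
split=> [x _|v]; first by apply: differentiable_pair; [exact: df | exact: dg].
rewrite [X in Ck_on _ _ X](_ : _ = fun x => ('D_v f x, 'D_v g x)).
  exact: (IH _ _ (Df v) (Dg v)).
by apply/funext => x; apply: derive_pair; [exact: df | exact: dg].
Qed.

Lemma derive_comp_scale (f df : R -> R) (c t v : R) :
  (forall t : R, is_derive t (1 : R) f (df t)) ->
  differentiable (fun t => f (c * t)) t /\
  'D_v (fun t => f (c * t)) t = (v * c) * df (c * t).
Proof.
move=> fdf; have Df : is_derive t (1 : R) (f \o *%R c) (df (c * t) * c).
  apply: is_derive1_comp; rewrite -[X in is_derive _ _ _ X]mulr1.
  exact: is_deriveZ.
have dfc : differentiable (f \o *%R c) t.
  by apply/derivable1_diffP; exact: ex_derive.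
split=> //; rewrite deriveE // -[X in 'd _ _ X]mulr1 linearZ /= -deriveE //.
by rewrite derive_val /= /GRing.scale /= mulrAC mulrA.
Qed.

(** Each of the two functions is, up to a constant, the derivative of the other; hence the joint
    induction. *)
Lemma Ck_cos_sin_scale k (c : R) :
  Ck_on k setT (fun t : R => cos (c * t)) /\
  Ck_on k setT (fun t : R => sin (c * t)).
Proof.
have dcos t v := derive_comp_scale c t v (@is_derive_cos R).
have dsin t v := derive_comp_scale c t v (@is_derive_sin R).
elim: k => [|k [IHc IHs]].
  split=> x _; apply: differentiable_continuous.
    exact: (dcos x 0).1.
  exact: (dsin x 0).1.
split; split=> [t _|v]; [exact: (dcos t 0).1 | | exact: (dsin t 0).1 |].
  rewrite [X in Ck_on _ _ X](_ : _ = fun t => (v * c * -1) * sin (c * t)).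
    exact: Ck_scale (Ck_cst _ _ _) IHs.
  by apply/funext => t; rewrite (dcos t v).2; ring.
rewrite [X in Ck_on _ _ X](_ : _ = fun t => (v * c) * cos (c * t)).
  exact: Ck_scale (Ck_cst _ _ _) IHc.
by apply/funext => t; rewrite (dsin t v).2.
Qed.

Lemma smooth_cos_scale (c : R) : smooth (fun t : R => cos (c * t)).
Proof. by move=> k; have [] := Ck_cos_sin_scale k c. Qed.

Lemma smooth_sin_scale (c : R) : smooth (fun t : R => sin (c * t)).
Proof. by move=> k; have [] := Ck_cos_sin_scale k c. Qed.

Lemma smooth_rotation V (L : {linear V -> V}) (c : R) (g : R -> V) :
  continuous L -> smooth g ->
  smooth (fun t => cos (c * t) *: g t + sin (c * t) *: L (g t)).
Proof.
move=> cL sg; apply: smooth_add; apply: smooth_scale => //.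
- exact: smooth_cos_scale.
- exact: smooth_sin_scale.
- exact: smooth_linear_comp.
Qed.

(** Applying a further rotation to a curve adds the infinitesimal rotation [c *: L (g 0)] to its
    velocity at 0. *)
Lemma derive_rotation0 V (L : {linear V -> V}) (c : R) (g : R -> V) :
  continuous L -> smooth g ->
  'D_1 (fun t => cos (c * t) *: g t + sin (c * t) *: L (g t)) 0
    = 'D_1 g 0 + c *: L (g 0).
Proof.
move=> cL sg.
have dg : differentiable g 0 by exact: smooth_differentiable.
have dLg : differentiable (fun t => L (g t)) 0.
  exact/smooth_differentiable/smooth_linear_comp.
have [dc Dc] := derive_comp_scale c 0 1 (@is_derive_cos R).
have [ds Ds] := derive_comp_scale c 0 1 (@is_derive_sin R).
have [d1 D1] := is_diff_scale dc dg.
have [d2 D2] := is_diff_scale ds dLg.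
rewrite deriveD ?D1 ?D2 ?Dc ?Ds; try exact: diff_derivable.
by rewrite mulr0 cos0 sin0 oppr0 mulr0 !scale0r !add0r addr0 scale1r mul1r mulr1.
Qed.

End SmoothCalculus.

(** * Orthonormal bases and quaternions *)

Section DotProduct.
Context {R : realType} {n : nat}.
Implicit Types u v w : 'cV[R]_n.

Lemma dotE u v : dot u v = (u^T *m v) 0 0.
Proof. by rewrite mxE; apply: eq_bigr => i _; rewrite mxE. Qed.

Lemma dotC u v : dot u v = dot v u.
Proof. by apply: eq_bigr => i _; rewrite mulrC. Qed.

Lemma dotDl u v w : dot (u + v) w = dot u w + dot v w.
Proof. by rewrite -big_split; apply: eq_bigr => i _; rewrite mxE mulrDl. Qed.

Lemma dotDr u v w : dot u (v + w) = dot u v + dot u w.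
Proof. by rewrite dotC dotDl !(dotC u). Qed.

Lemma dotZl c u v : dot (c *: u) v = c * dot u v.
Proof. by rewrite /dot mulr_sumr; apply: eq_bigr => i _; rewrite mxE mulrA. Qed.

Lemma dotZr c u v : dot u (c *: v) = c * dot u v.
Proof. by rewrite dotC dotZl dotC. Qed.

Lemma dotNl u v : dot (- u) v = - dot u v.
Proof. by rewrite -scaleN1r dotZl mulN1r. Qed.

Lemma dotNr u v : dot u (- v) = - dot u v.
Proof. by rewrite dotC dotNl dotC. Qed.

Lemma dot0l v : dot 0 v = 0.
Proof. by rewrite -(scale0r 0) dotZl mul0r. Qed.

Lemma dot_suml (I : Type) (r : seq I) (f : I -> 'cV[R]_n) v :
  dot (\sum_(i <- r) f i) v = \sum_(i <- r) dot (f i) v.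
Proof. by elim/big_rec2: _ => [|i a b _ <-]; rewrite ?dot0l ?dotDl. Qed.

Lemma dot_eq0 u : (dot u u == 0) = (u == 0).
Proof.
apply/eqP/eqP => [|->]; last exact: dot0l.
move/eqP; rewrite psumr_eq0 => [/allP u0|i _]; last by rewrite -expr2 sqr_ge0.
apply/colP => i; have := u0 i (mem_index_enum _).
by rewrite mulf_eq0 orbb mxE => /eqP.
Qed.

Lemma dot_ge0 u : 0 <= dot u u.
Proof. by apply: sumr_ge0 => i _; rewrite -expr2 sqr_ge0. Qed.

(** Orthonormal columns of a square matrix satisfy [M^T *m M = 1], hence also [M *m M^T = 1], which
    is the expansion formula. *)
Lemma dot_basis (b : 'I_n -> 'cV[R]_n) v :
  (forall i j, dot (b i) (b j) = (i == j)%:R) -> v = \sum_i dot v (b i) *: b i.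
Proof.
move=> ob; pose M := \matrix_(i, j) b j i 0.
have MtM : M^T *m M = 1%:M.
  apply/matrixP => i j; rewrite !mxE -ob; apply: eq_bigr => k _.
  by rewrite !mxE.
rewrite -[LHS]mul1mx -(mulmx1C MtM) -mulmxA; apply/colP => i.
rewrite mxE summxE; apply: eq_bigr => j _; rewrite !mxE mulrC; congr (_ * _).
by apply: eq_bigr => k _; rewrite !mxE mulrC.
Qed.

End DotProduct.

Lemma dot_mulmxl (R : realType) m n (M : 'M[R]_(m, n)) u v :
  dot (M *m u) v = dot u (M^T *m v).
Proof. by rewrite !dotE trmx_mul mulmxA. Qed.

(** Gram-Schmidt inside the kernel of [M]: columns are added one at a time as long as the rank
    leaves room. *)
Lemma orthonormal_kernel (R : realType) m n k (M : 'M[R]_(m, n)) :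
  (\rank M + k <= n)%N ->
  exists U : 'M[R]_(n, k), M *m U = 0 /\ U^T *m U = 1%:M.
Proof.
elim: k => [|k IH] Mk.
  by exists 0; rewrite mulmx0; split=> //; apply/matrixP => -[].
have [|U [MU UU]] := IH; first by rewrite (leq_trans _ Mk) // leq_add2l.
(* A nonzero vector killed by [M] and orthogonal to the columns found so far exists, the stacked
   matrix having rank at most [\rank M + k < n]. *)
have /rowV0Pn[w] : kermx (col_mx M U^T)^T != 0.
  rewrite kermx_eq0 /row_free mxrank_tr neq_ltn.
  rewrite (@leq_ltn_trans (\rank M + k)) //; last by rewrite -addnS.
  apply: leq_trans (_ : \rank M + \rank U^T <= _)%N.
    by rewrite -addsmxE mxrank_adds_leqif.
  by rewrite leq_add2l rank_leq_row.
move=> /sub_kermxP; rewrite tr_col_mx mul_mx_row trmxK => /eqP.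
rewrite row_mx_eq0 => /andP[/eqP wM /eqP wU] w0.
have Mw : M *m w^T = 0 by rewrite -[M]trmxK -trmx_mul wM trmx0.
have N0 : dot w^T w^T != 0 by rewrite dot_eq0 trmx_eq0.
pose w1 := (Num.sqrt (dot w^T w^T))^-1 *: w^T.
have w11 : w1^T *m w1 = 1%:M.
  rewrite [LHS]mx11_scalar -dotE /w1 dotZl dotZr mulrA -expr2 exprVn.
  by rewrite sqr_sqrtr ?dot_ge0 // mulVf.
have Uw1 : U^T *m w1 = 0.
  by rewrite /w1 -scalemxAr -trmx_mul wU trmx0 scaler0.
(* Reading [k.+1] as [1 + k] lets the new unit vector be prepended as a block. *)
suff : exists V : 'M[R]_(n, 1 + k), M *m V = 0 /\ V^T *m V = 1%:M by [].
exists (row_mx w1 U); rewrite mul_mx_row MU /w1 -scalemxAr Mw scaler0 row_mx0.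
split=> //; rewrite -/w1 tr_row_mx mul_col_row w11 UU Uw1.
by rewrite -[w1^T *m U]trmxK trmx_mul trmxK Uw1 trmx0 -scalar_mx_block.
Qed.

(** * Quaternion multiplications on R^4 *)

Section Quaternions.
Context {R : realType}.

Definition mx_of_seq m n (s : seq (seq R)) : 'M[R]_(m, n) :=
  \matrix_(i, j) (nth [::] s i)`_j.

(* Right multiplications by i, j, k on the quaternions, then left ones. *)
Definition quat (k : 'I_6) : 'M[R]_4 := mx_of_seq 4 4 (nth [::] [::
  [:: [:: 0; -1; 0; 0]; [:: 1; 0; 0; 0]; [:: 0; 0; 0; 1]; [:: 0; 0; -1; 0]];
  [:: [:: 0; 0; -1; 0]; [:: 0; 0; 0; -1]; [:: 1; 0; 0; 0]; [:: 0; 1; 0; 0]];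
  [:: [:: 0; 0; 0; -1]; [:: 0; 0; 1; 0]; [:: 0; -1; 0; 0]; [:: 1; 0; 0; 0]];
  [:: [:: 0; -1; 0; 0]; [:: 1; 0; 0; 0]; [:: 0; 0; 0; -1]; [:: 0; 0; 1; 0]];
  [:: [:: 0; 0; -1; 0]; [:: 0; 0; 0; 1]; [:: 1; 0; 0; 0]; [:: 0; -1; 0; 0]];
  [:: [:: 0; 0; 0; -1]; [:: 0; 0; -1; 0]; [:: 0; 1; 0; 0]; [:: 1; 0; 0; 0]]] k).

Lemma quat_skew k : (quat k)^T = - quat k.
Proof.
apply/matrixP => i j; rewrite !mxE.
by case: k i j => [[|[|[|[|[|[|?]]]]]] ?] [[|[|[|[|?]]]] ?] [[|[|[|[|?]]]] ?] //=;
  rewrite ?opprK ?oppr0.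
Qed.

Lemma quat_sqr k : quat k *m quat k = - 1%:M.
Proof.
apply/matrixP => i j; rewrite !mxE !big_ord_recl big_ord0 !mxE.
case: k i j => [[|[|[|[|[|[|?]]]]]] ?] [[|[|[|[|?]]]] ?] [[|[|[|[|?]]]] ?] //=;
  ring.
Qed.

(** Explicit coordinates, in which the quaternion identities become polynomial identities entry by
    entry. *)
Definition col4 (a0 a1 a2 a3 : R) : 'cV[R]_4 := \col_i [:: a0; a1; a2; a3]`_i.

Lemma col4_eta (u : 'cV[R]_4) : exists a0 a1 a2 a3, u = col4 a0 a1 a2 a3.
Proof.
exists (u ord0 0), (u (lift ord0 ord0) 0), (u (lift ord0 (lift ord0 ord0)) 0),
  (u (lift ord0 (lift ord0 (lift ord0 ord0))) 0).
apply/colP => i; rewrite mxE.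
by case: i => [[|[|[|[|?]]]] ?] //=; congr (u _ 0); exact: val_inj.
Qed.

Lemma dot_col4 a0 a1 a2 a3 b0 b1 b2 b3 :
  dot (col4 a0 a1 a2 a3) (col4 b0 b1 b2 b3)
    = a0 * b0 + a1 * b1 + a2 * b2 + a3 * b3.
Proof. by rewrite /dot !big_ord_recl big_ord0 !mxE /= addr0 !addrA. Qed.

Lemma col4D a0 a1 a2 a3 b0 b1 b2 b3 :
  col4 a0 a1 a2 a3 + col4 b0 b1 b2 b3
    = col4 (a0 + b0) (a1 + b1) (a2 + b2) (a3 + b3).
Proof. by apply/colP => i; rewrite !mxE; case: i => [[|[|[|[|?]]]] ?]. Qed.

Lemma col4Z c a0 a1 a2 a3 :
  c *: col4 a0 a1 a2 a3 = col4 (c * a0) (c * a1) (c * a2) (c * a3).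
Proof. by apply/colP => i; rewrite !mxE; case: i => [[|[|[|[|?]]]] ?]. Qed.

Lemma quat_col4 k a0 a1 a2 a3 :
  quat k *m col4 a0 a1 a2 a3 = nth 0 [::
    col4 (- a1) a0 a3 (- a2); col4 (- a2) (- a3) a0 a1;
    col4 (- a3) a2 (- a1) a0; col4 (- a1) a0 (- a3) a2;
    col4 (- a2) a3 a0 (- a1); col4 (- a3) (- a2) a1 a0] k.
Proof.
apply/colP => i; rewrite mxE !big_ord_recl big_ord0 !mxE /=.
case: k i => [[|[|[|[|[|[|?]]]]]] ?] [[|[|[|[|?]]]] ?] //=; rewrite !mxE /=; ring.
Qed.

(** The bound 3 selects the right multiplications: [u i], [u j], [u k] are pairwise orthogonal and
    as long as [u]. *)
Lemma quat_orthogonal (j k : 'I_6) (u : 'cV[R]_4) : (j < 3)%N -> (k < 3)%N ->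
  dot (quat j *m u) (quat k *m u) = (j == k)%:R * dot u u.
Proof.
have [a0 [a1 [a2 [a3 ->]]]] := col4_eta u; rewrite !quat_col4.
by case: j k => [[|[|[|[|[|[|?]]]]]] ?] [[|[|[|[|[|[|?]]]]]] ?] //= _ _;
  rewrite !dot_col4; ring.
Qed.

(** The six matrices form an orthogonal basis of so(4). For the elementary skew matrices the same
    sum has factor 1; the quaternion matrices have twice their squared norm, hence the 2. *)
Lemma quat_casimir (a b u : 'cV[R]_4) :
  \sum_k dot (quat k *m a) u *: (quat k *m b)
    = 2 *: (dot a b *: u - dot b u *: a).
Proof.
have [a0 [a1 [a2 [a3 ->]]]] := col4_eta a.
have [b0 [b1 [b2 [b3 ->]]]] := col4_eta b.
have [u0 [u1 [u2 [u3 ->]]]] := col4_eta u.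
rewrite !big_ord_recl big_ord0 addr0 !quat_col4 /= !dot_col4 -scaleNr.
rewrite !(col4Z, col4D); congr col4; ring.
Qed.

End Quaternions.

(* The vectors refl_re j + i refl_im j are the images of the n j under the
   unitary reflection of C^N that takes i m to b, the n j being real and
   orthogonal to m. *)
Section ReflectedFrame.
Context {R : realType} {N : nat} (I : eqType).
Variables (b m : 'cV[R]_N) (n : I -> 'cV[R]_N).

(** With t = [dot m b], the reflection is x |-> x - (<x, im - b> / (1 - it)) (im - b), the Hermitian
    form being linear in x. On [n j] it gives [n j] - ([dot (n j) b] / (1 + t^2)) (1 + it)(b - im),
    whose real and imaginary parts are the two fields below. *)
Definition refl_coef j : R := dot (n j) b / (1 + dot m b ^+ 2).

Definition refl_re j := n j - refl_coef j *: (b + dot m b *: m).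

Definition refl_im j := - refl_coef j *: (dot m b *: b - m).

Hypotheses (bb : dot b b = 1) (mm : dot m m = 1).
Hypotheses (nn : forall j k, dot (n j) (n k) = (j == k)%:R).
Hypothesis (nm : forall j, dot (n j) m = 0).

(** The denominator is |1 - it|^2, positive for all real [b] and [m], so the fields are smooth off
    the focal submanifold too. *)
Lemma refl_denom_neq0 : 1 + dot m b ^+ 2 != 0.
Proof. by rewrite gt_eqF // ltr_pwDl // sqr_ge0. Qed.

Lemma refl_orthogonal a j : (forall k, dot (n k) a = 0) -> dot m a = 0 ->
  dot b a = 0 -> dot (refl_re j) a = 0 /\ dot (refl_im j) a = 0.
Proof.
move=> na ma ba; rewrite /refl_re /refl_im.
by rewrite !(dotDl, dotZl, dotNl) na ma ba; split; ring.
Qed.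

(** [n j] is orthogonal to [i m], so its unitary image is orthogonal to the image [b] of [i m]; as
    [b] is real, this holds for both parts. *)
Lemma refl_orthogonal_center j :
  dot (refl_re j) b = 0 /\ dot (refl_im j) b = 0.
Proof.
rewrite /refl_re /refl_im !(dotDl, dotZl, dotNl) bb /refl_coef.
by have D0 := refl_denom_neq0; split; field.
Qed.

(** The real and imaginary parts of the Hermitian products of the images, which a unitary map leaves
    equal to those of the [n j]. *)
Lemma refl_orthonormal j k :
  dot (refl_re j) (refl_re k) + dot (refl_im j) (refl_im k) = (j == k)%:R /\
  dot (refl_im j) (refl_re k) = dot (refl_re j) (refl_im k).
Proof.
rewrite /refl_re /refl_im !(dotDl, dotZl, dotNl) !(dotDr, dotZr, dotNr).
rewrite nn (dotC m (n _)) (dotC b (n _)) (dotC b m) !nm bb mm /refl_coef.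
by have D0 := refl_denom_neq0; split; field.
Qed.

End ReflectedFrame.

(** * Coordinates adapted to a Clifford system *)

Section CliffordCoordinates.
Context {R : realType} (P : 'I_2 -> 'M[R]_8).
Hypothesis hP : symmetric_clifford_system P.

Lemma clifford_sym i : (P i)^T = P i. Proof. by case: hP. Qed.

Lemma clifford_sqr i : P i *m P i = 1%:M.
Proof.
have [_ /(_ i i)] := hP; rewrite eqxx mulr1 => PP.
apply: (scalerI (a := 2)); first by rewrite pnatr_eq0.
by rewrite scale_scalar_mx mulr1 -PP scaler_nat mulr2n.
Qed.

Lemma clifford_anticomm : P 1 *m P 0 = - (P 0 *m P 1).
Proof.
by have [_ /(_ 1%R 0%R)] := hP; rewrite mulr0 -scalemx1 scale0r => /eqP;
  rewrite addr_eq0 => /eqP.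
Qed.

(* P 1 exchanges the two eigenspaces of P 0, so both have dimension 4. *)
Lemma clifford_basis :
  exists U : 'M[R]_(8, 4), P 0 *m U = U /\ U^T *m U = 1%:M.
Proof.
have rk : (\rank (P 0 - 1%:M)%R + 4 <= 8)%N.
  have P1u : P 1 \in unitmx by have [] := mulmx1_unit (clifford_sqr 1).
  have E : P 1 *m (P 0 - 1%:M) *m P 1 = - (P 0 + 1%:M).
    rewrite mulmxBr mulmx1 mulmxBl clifford_sqr clifford_anticomm mulNmx.
    by rewrite -mulmxA clifford_sqr mulmx1 opprD.
  (* Since (P_0 - 1)(P_0 + 1) = 0, the two ranks add up to at most 8; by [E] they are equal. *)
  have := mulmx0_rank_max (A := P 0 - 1%:M) (B := P 0 + 1%:M).
  rewrite mulmxDr mulmxBl clifford_sqr mul1mx mulmx1 addrA subrK subrr.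
  move=> /(_ erefl).
  rewrite -(mxrank_opp (P 0 + 1%:M)) -E mxrankMfree ?row_free_unit //.
  rewrite eqmxMfull ?row_full_unit // addnn => h.
  by rewrite -[8%N]/(4 + 4)%N leq_add2r -leq_double.
have [U [PU UU]] := orthonormal_kernel rk; exists U; split=> //.
by move/eqP: PU; rewrite mulmxBl mul1mx subr_eq0 => /eqP.
Qed.

Variables U W : 'M[R]_(8, 4).
Hypotheses (P0U : P 0 *m U = U) (P1U : P 1 *m U = W) (UU : U^T *m U = 1%:M).

(* The pair (a, b) stands for a + i b in the complexified quaternions, where i
   acts as P 1 *m P 0 = - (P 0 *m P 1). *)
Definition emb (a b : 'cV[R]_4) : 'cV[R]_8 := U *m a + W *m b.

Lemma P1W : P 1 *m W = U.
Proof. by rewrite -P1U mulmxA clifford_sqr mul1mx. Qed.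

Lemma P0W : P 0 *m W = - W.
Proof.
by rewrite -P1U mulmxA -[P 0 *m P 1]opprK -clifford_anticomm mulNmx -mulmxA P0U.
Qed.

(** The columns of [U] and [W] are eigenvectors of the symmetric [P 0] for the distinct eigenvalues
    1 and -1. *)
Lemma UW : U^T *m W = 0.
Proof.
have E : U^T *m W = - (U^T *m W).
  by rewrite -{1}P0U trmx_mul clifford_sym -mulmxA P0W mulmxN.
apply: (scalerI (a := 2)); first by rewrite pnatr_eq0.
by rewrite scaler0 scaler_nat mulr2n {2}E subrr.
Qed.

Lemma WU : W^T *m U = 0.
Proof. by rewrite -[LHS]trmxK trmx_mul trmxK UW trmx0. Qed.

Lemma WW : W^T *m W = 1%:M.
Proof. by rewrite -{1}P1U trmx_mul clifford_sym -mulmxA P1W. Qed.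

Lemma emb_fst a b : U^T *m emb a b = a.
Proof. by rewrite mulmxDr !mulmxA UU UW mul0mx addr0 mul1mx. Qed.

Lemma emb_snd a b : W^T *m emb a b = b.
Proof. by rewrite mulmxDr !mulmxA WU WW mul0mx add0r mul1mx. Qed.

Lemma dot_emb a b a' b' : dot (emb a b) (emb a' b') = dot a a' + dot b b'.
Proof. by rewrite {1}/emb dotDl !dot_mulmxl emb_fst emb_snd. Qed.

(** The square matrix [row_mx U W] has orthonormal columns, hence orthonormal rows. *)
Lemma UUWW : U *m U^T + W *m W^T = 1%:M.
Proof.
have QQ : (row_mx U W)^T *m row_mx U W = 1%:M :> 'M[R]_(4 + 4).
  by rewrite tr_row_mx mul_col_row UU UW WU WW -scalar_mx_block.
by rewrite -mul_row_col -tr_row_mx; exact: mulmx1C.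
Qed.

Lemma emb_eta x : emb (U^T *m x) (W^T *m x) = x.
Proof. by rewrite /emb !mulmxA -mulmxDl UUWW mul1mx. Qed.

Lemma embD a b a' b' : emb a b + emb a' b' = emb (a + a') (b + b').
Proof. by rewrite /emb !mulmxDr addrACA. Qed.

Lemma embZ c a b : c *: emb a b = emb (c *: a) (c *: b).
Proof. by rewrite /emb -!scalemxAr scalerDr. Qed.

Lemma P0_emb a b : P 0 *m emb a b = emb a (- b).
Proof. by rewrite /emb mulmxDr !mulmxA P0U P0W mulNmx mulmxN. Qed.

Lemma P1_emb a b : P 1 *m emb a b = emb b a.
Proof. by rewrite /emb mulmxDr !mulmxA P1U P1W addrC. Qed.

Lemma eta_emb a b : eta P (emb a b) = emb b (- a).
Proof. by rewrite /eta -mulmxA P1_emb P0_emb. Qed.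

Lemma focal_emb a b :
  focal P (emb a b) <-> [/\ dot a a = 2^-1, dot b b = 2^-1 & dot a b = 0].
Proof.
rewrite /focal /= P0_emb P1_emb !dot_emb dotNl (dotC b a).
by split=> [[]|[]] *; split; lra.
Qed.

(** The complex-linear extension of [E]: it acts on the real and the imaginary part at once. *)
Definition hat (E : 'M[R]_4) : 'M[R]_8 := U *m E *m U^T + W *m E *m W^T.

Lemma hat_emb E a b : hat E *m emb a b = emb (E *m a) (E *m b).
Proof. by rewrite mulmxDl -!mulmxA emb_fst emb_snd. Qed.

(** The linearized equations of [focal]; [tangent_focalE] identifies their solutions with the
    velocities of curves. *)
Definition focal_tangent (x X : 'cV[R]_8) : Prop :=
  [/\ dot x X = 0, dot (P 0 *m x) X = 0 & dot (P 1 *m x) X = 0].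

(* The quadratic Casimir element of so(4), acting on R^4 + R^4, writes a
   tangent vector as a combination of velocities of rotations. *)
Lemma focal_tangent_casimir x X : focal P x -> focal_tangent x X ->
  X = \sum_k dot (hat (quat k) *m x) X *: (hat (quat k) *m x)
      - dot (eta P x) X *: eta P x.
Proof.
rewrite -(emb_eta x) -(emb_eta X); set a := U^T *m x; set b := W^T *m x.
set u := U^T *m X; set w := W^T *m X; rewrite focal_emb => -[aa bb ab].
rewrite /focal_tangent P0_emb P1_emb eta_emb !dot_emb !dotNl => -[h0 h1 h2].
have -> : \sum_k dot (hat (quat k) *m emb a b) (emb u w) *:
      (hat (quat k) *m emb a b)
  = emb (\sum_k dot (quat k *m a) u *: (quat k *m a)
         + \sum_k dot (quat k *m b) w *: (quat k *m a))
        (\sum_k dot (quat k *m a) u *: (quat k *m b)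
         + \sum_k dot (quat k *m b) w *: (quat k *m b)).
  rewrite -!big_split /emb !mulmx_sumr -big_split; apply: eq_bigr => k _ /=.
  by rewrite -/(emb _ _) hat_emb dot_emb embZ !scalerDl.
rewrite !quat_casimir embZ -[- emb _ _]scaleN1r embZ embD (dotC b a) aa bb ab.
(* Tangency says a.u + b.w = 0, a.u - b.w = 0 and b.u + a.w = 0. The Casimir sums then give X + 2
   (a.w) (-b, a), and the [eta] term cancels the excess. *)
have -> : dot a u = 0 by lra.
have -> : dot b w = 0 by lra.
have -> : dot b u = - dot a w by lra.
by congr emb; apply/colP => i; rewrite !mxE; field.
Qed.

Definition focal_rotation (B : 'M[R]_8) : Prop :=
  forall c s x, c ^+ 2 + s ^+ 2 = 1 -> focal P x ->
    focal P (c *: x + s *: (B *m x)).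

(** [quat k] is skew with square -1, so c + s [quat k] is orthogonal; acting on both [a] and [b], it
    preserves their inner products. *)
Lemma hat_rotation k : focal_rotation (hat (quat k)).
Proof.
move=> c s x cs; rewrite -(emb_eta x); set a := U^T *m x; set b := W^T *m x.
rewrite focal_emb hat_emb !embZ embD focal_emb => -[aa bb ab].
have skew (u v : 'cV[R]_4) : dot (quat k *m u) v = - dot u (quat k *m v).
  by rewrite dot_mulmxl quat_skew mulNmx dotNr.
have iso (u v : 'cV[R]_4) : dot (quat k *m u) (quat k *m v) = dot u v.
  by rewrite skew mulmxA quat_sqr mulNmx mul1mx dotNr opprK.
rewrite !(dotDl, dotDr, dotZl, dotZr) !iso aa bb ab.
have z (u : 'cV[R]_4) : dot u (quat k *m u) = 0.
  by have := skew u u; rewrite dotC; lra.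
have z' (u : 'cV[R]_4) : dot (quat k *m u) u = 0 by rewrite dotC z.
rewrite !z !z' skew; split; nra.
Qed.

(** The pair becomes (c a + s b, c b - s a), a rotation within the plane of two orthogonal vectors
    of equal length. *)
Lemma eta_rotation : focal_rotation (P 0 *m P 1).
Proof.
move=> c s x cs; rewrite -/(eta P x) -(emb_eta x).
set a := U^T *m x; set b := W^T *m x.
rewrite focal_emb eta_emb !embZ embD focal_emb => -[aa bb ab].
rewrite !(dotDl, dotDr, dotZl, dotZr, dotNl, dotNr) (dotC b a) aa bb ab.
split; nra.
Qed.

End CliffordCoordinates.

(** * An orthonormal basis of R^8 along the focal submanifold *)

Section FocalFrame.
Context {R : realType} (P : 'I_2 -> 'M[R]_8).
Hypothesis hP : symmetric_clifford_system P.
Variables U W : 'M[R]_(8, 4).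
Hypotheses (P0U : P 0 *m U = U) (P1U : P 1 *m U = W) (UU : U^T *m U = 1%:M).

(** The last two hypotheses on [u] and [v] say that the complex vectors u_k + i v_k are Hermitian
    orthonormal; the final four vectors are these and their multiples by -i. The factor [r]
    normalizes pairs of unit vectors. *)
Lemma emb_orthonormal (r : R) (a b : 'cV[R]_4) (u v : 'I_2 -> 'cV[R]_4) i j :
  r * r = 2^-1 -> dot a a = 1 -> dot b b = 1 -> dot a b = 0 ->
  (forall k, dot (u k) a = 0) -> (forall k, dot (v k) a = 0) ->
  (forall k, dot (u k) b = 0) -> (forall k, dot (v k) b = 0) ->
  (forall k l, dot (u k) (u l) + dot (v k) (v l) = (k == l)%:R) ->
  (forall k l, dot (v k) (u l) = dot (u k) (v l)) ->
  let e := nth 0 [::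
    r *: emb U W a b; r *: emb U W a (- b); r *: emb U W b a;
    r *: emb U W b (- a); emb U W (u 0) (v 0); emb U W (u 1) (v 1);
    emb U W (v 0) (- u 0); emb U W (v 1) (- u 1)] in
  (i < 8)%N -> (j < 8)%N -> dot (e i) (e j) = (i == j)%:R.
Proof.
move=> r2 aa bb ab ua va ub vb uv vu e.
(* Symmetry of the inner product leaves only the upper triangle of the Gram matrix. *)
wlog ij : i j / (i <= j)%N => [hw|].
  move=> i8 j8; have [/hw|/ltnW/hw] := leqP i j; first exact.
  by move=> h; rewrite dotC eq_sym h.
have ba : dot b a = 0 by rewrite dotC.
have au k : dot a (u k) = 0 by rewrite dotC.
have av k : dot a (v k) = 0 by rewrite dotC.
have bu k : dot b (u k) = 0 by rewrite dotC.
have bv k : dot b (v k) = 0 by rewrite dotC.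
have uv' k l : dot (u k) (u l) = (k == l)%:R - dot (v k) (v l).
  by rewrite -uv addrK.
have dE := dot_emb hP P0U P1U UU.
rewrite /e => {e} i8 j8.
case: i j i8 j8 ij =>
  [|[|[|[|[|[|[|[|?]]]]]]]] [|[|[|[|[|[|[|[|?]]]]]]]] //= _ _ _;
  rewrite ?(dotZl, dotZr) dE ?(dotNl, dotNr) ?aa ?bb ?ab ?ba ?ua ?va ?ub ?vb
    ?au ?av ?bu ?bv ?vu ?uv' ?eqxx /=;
  rewrite ?mulrA ?r2; try lra.
Qed.

(** The factor sqrt 2 turns the two components of a focal point, of squared length 1/2, into unit
    vectors. *)
Definition focal_coord (V : 'M[R]_(8, 4)) (x : 'cV[R]_8) :=
  Num.sqrt 2 *: (V^T *m x).

(** The reflection is done in C^4 rather than C^3: [n 0], [n 1] and the centre [m] are [a i], [a j],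
    [a k], an orthogonal basis of the complement of [a], in which [b] lies on the focal
    submanifold. *)
Definition focal_field (j : 'I_2) (x : 'cV[R]_8) : 'cV[R]_8 :=
  let a := focal_coord U x in let b := focal_coord W x in
  let n k := quat (widen_ord (isT : 2 <= 6)%N k) *m a in
  emb U W (refl_re b (quat 2 *m a) n j) (refl_im b (quat 2 *m a) n j).

(** On the focal submanifold, entries 0 to 2 span the normal space, entry 3 is [eta], and the last
    four span V. *)
Definition focal_basis (x : 'cV[R]_8) (i : 'I_8) : 'cV[R]_8 :=
  nth 0 [:: x; P 0 *m x; P 1 *m x; eta P x; focal_field 0 x; focal_field 1 x;
            eta P (focal_field 0 x); eta P (focal_field 1 x)] i.

Lemma focal_basis_orthonormal x i j : focal P x ->
  dot (focal_basis x i) (focal_basis x j) = (i == j)%:R.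
Proof.
have s2 : Num.sqrt 2 ^+ 2 = 2 :> R by rewrite sqr_sqrtr.
have s20 : Num.sqrt 2 != 0 :> R by rewrite sqrtr_eq0 -ltNge.
rewrite -[x in focal P x](emb_eta hP P0U P1U UU) (focal_emb hP) // => -[uu ww uw].
pose a := focal_coord U x; pose b := focal_coord W x.
pose n (k : 'I_2) := quat (widen_ord (isT : 2 <= 6)%N k) *m a.
have aa : dot a a = 1 by rewrite dotZl dotZr uu mulrA -expr2 s2 divff.
have bb : dot b b = 1 by rewrite dotZl dotZr ww mulrA -expr2 s2 divff.
have ab : dot a b = 0 by rewrite dotZl dotZr uw !mulr0.
have xE : x = (Num.sqrt 2)^-1 *: emb U W a b.
  by rewrite embZ /a /b !scalerA mulVf // !scale1r (emb_eta hP).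
have lt3 (k : 'I_2) : (widen_ord (isT : 2 <= 6)%N k < 3)%N.
  exact: leq_trans (ltn_ord k) _.
have mm : dot (quat 2 *m a) (quat 2 *m a) = 1.
  by rewrite quat_orthogonal // eqxx mul1r.
have nn k l : dot (n k) (n l) = (k == l)%:R.
  by rewrite quat_orthogonal // aa mulr1.
have nm k : dot (n k) (quat 2 *m a) = 0.
  rewrite quat_orthogonal //.
  by case: k => [[|[|?]] ?] //; rewrite mul0r.
(* Skewness of [quat k] makes [quat k *m a] orthogonal to [a]. *)
have qa k : dot (quat k *m a) a = 0.
  by have := dot_mulmxl (quat k) a a;
    rewrite quat_skew mulNmx dotNr [X in - X]dotC; lra.
have ba : dot b a = 0 by rewrite dotC.
pose u := refl_re b (quat 2 *m a) n; pose v := refl_im b (quat 2 *m a) n.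
have fa k : dot (u k) a = 0 /\ dot (v k) a = 0.
  by apply: refl_orthogonal => // l; exact: qa.
have fb k : dot (u k) b = 0 /\ dot (v k) b = 0.
  by apply: refl_orthogonal_center.
have fg k l := refl_orthonormal bb mm nn nm k l.
have r2 : (Num.sqrt 2)^-1 * (Num.sqrt 2)^-1 = 2^-1 :> R.
  by rewrite -expr2 exprVn s2.
have := emb_orthonormal r2 aa bb ab (fun k => (fa k).1) (fun k => (fa k).2)
  (fun k => (fb k).1) (fun k => (fb k).2) (fun k l => (fg k l).1)
  (fun k l => (fg k l).2) (ltn_ord i) (ltn_ord j).
rewrite /focal_basis -(inj_eq val_inj i j) /= => <-.
have E0 := eta_emb hP P0U P1U.
have Ex : eta P x = (Num.sqrt 2)^-1 *: emb U W b (- a).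
  by rewrite {1}xE /eta -scalemxAr -/(eta P _) E0.
have E2 : P 0 *m x = (Num.sqrt 2)^-1 *: emb U W a (- b).
  by rewrite {1}xE -scalemxAr (P0_emb hP).
have E3 : P 1 *m x = (Num.sqrt 2)^-1 *: emb U W b a.
  by rewrite {1}xE -scalemxAr (P1_emb hP).
by rewrite Ex E2 E3 !E0 -xE.
Qed.

End FocalFrame.

(** * Tangent spaces *)

Section SmoothMatrix.
Context {R : realType}.
Local Notation smooth := (smooth_on setT).

(** Named so as to carry a linear structure; taking an entry is then composition with a linear
    map. *)
Definition mx_coord m n (i : 'I_m) (j : 'I_n) (A : 'M[R]_(m, n)) : R := A i j.

Fact mx_coord_is_linear m n (i : 'I_m) (j : 'I_n) : linear (mx_coord i j).
Proof. by move=> c A B; rewrite /mx_coord !mxE. Qed.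

HB.instance Definition _ m n (i : 'I_m) (j : 'I_n) :=
  GRing.isLinear.Build R 'M[R]_(m, n) R _ (mx_coord i j) (mx_coord_is_linear i j).

Lemma continuous_mx_coord m n (i : 'I_m) (j : 'I_n) : continuous (mx_coord i j).
Proof. exact: coord_continuous. Qed.

Lemma smooth_coord_comp (V : normedModType R) m n (i : 'I_m) (j : 'I_n)
  (f : V -> 'M[R]_(m, n)) : smooth f -> smooth (fun x => f x i j : R).
Proof. exact/(smooth_linear_comp (L := mx_coord i j))/continuous_mx_coord. Qed.

Lemma smooth_mulmx m n (M : 'M[R]_(m, n)) :
  smooth (mulmx M : 'cV[R]_n -> 'cV[R]_m).
Proof.
have -> : mulmx M = (fun x : 'cV[R]_n => \sum_j x j 0 *: col j M).
  apply/funext => x; apply/colP => i; rewrite mxE summxE.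
  by apply: eq_bigr => j _; rewrite !mxE mulrC.
apply: smooth_sum => j; apply: smooth_scale; last exact: smooth_cst.
by apply: smooth_coord_comp; exact: smooth_id.
Qed.

Lemma continuous_mulmx m n (M : 'M[R]_(m, n)) :
  continuous (mulmx M : 'cV[R]_n -> 'cV[R]_m).
Proof. exact/smooth_continuous/smooth_mulmx. Qed.

Lemma smooth_mulmx_comp (V : normedModType R) m n (M : 'M[R]_(m, n))
  (f : V -> 'cV[R]_n) :
  smooth f -> smooth (fun x => M *m f x).
Proof. exact/smooth_linear_comp/continuous_mulmx. Qed.

Lemma is_diff_coord (V : normedModType R) m n (f : V -> 'M[R]_(m, n)) i j x :
  differentiable f x -> differentiable (fun y => f y i j : R) x /\
  forall v, 'D_v (fun y => f y i j : R) x = 'D_v f x i j.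
Proof.
move=> df; have cL := @continuous_mx_coord m n i j.
split=> [|v]; last exact: (derive_linear_comp (L := mx_coord i j) _ cL df).
apply: (differentiable_comp (g := mx_coord i j)) => //.
exact: linear_differentiable.
Qed.

Lemma is_diff_dot (V : normedModType R) n (f g : V -> 'cV[R]_n) x :
  differentiable f x -> differentiable g x ->
  differentiable (fun y => dot (f y) (g y)) x /\
  forall v, 'D_v (fun y => dot (f y) (g y)) x
    = dot ('D_v f x) (g x) + dot (f x) ('D_v g x).
Proof.
move=> df dg.
have D i := is_diff_scale (is_diff_coord i 0 df).1 (is_diff_coord i 0 dg).1.
have -> : (fun y => dot (f y) (g y)) = \sum_i (fun y => f y i 0 *: g y i 0).
  by apply/funext => y; rewrite fct_sumE.
split=> [|v]; first by apply: differentiable_sum => i; exact: (D i).1.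
rewrite derive_sum => [|i]; last exact/diff_derivable/(D i).1.
rewrite /dot -big_split; apply: eq_bigr => i _ /=.
by rewrite (D i).2 (is_diff_coord i 0 df).2 (is_diff_coord i 0 dg).2.
Qed.

Lemma smooth_dot (V : normedModType R) n (f g : V -> 'cV[R]_n) :
  smooth f -> smooth g -> smooth (fun x => dot (f x) (g x)).
Proof.
move=> sf sg; apply: smooth_sum => i.
by apply: smooth_mul; exact: smooth_coord_comp.
Qed.

End SmoothMatrix.

(** * Curves in the focal submanifold and in the circle *)

Section FocalTangent.
Context {R : realType} (P : 'I_2 -> 'M[R]_8).
Hypothesis hP : symmetric_clifford_system P.
Local Notation smooth := (smooth_on setT).

(** A product of rotations applied to [x]; each entry of [s] is an angular velocity with its
    generator. *)
Definition rotation_curve (s : seq (R * 'M[R]_8)) (x : 'cV[R]_8) (t : R) :=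
  foldr (fun p y => cos (p.1 * t) *: y + sin (p.1 * t) *: (p.2 *m y)) x s.

Lemma rotation_curve_smooth s x : smooth (rotation_curve s x).
Proof.
elim: s => [|p s IH]; first exact: smooth_cst.
exact: (smooth_rotation (L := mulmx p.2) _ (@continuous_mulmx _ _ _ _)).
Qed.

Lemma rotation_curve0 s x : rotation_curve s x 0 = x.
Proof.
by elim: s => //= p s ->; rewrite mulr0 cos0 sin0 scale1r scale0r addr0.
Qed.

Lemma rotation_curve_velocity s x :
  'D_1 (rotation_curve s x) 0 = \sum_(p <- s) p.1 *: (p.2 *m x).
Proof.
elim: s => [|p s IH]; first by rewrite big_nil; exact: derive_cst.
have := derive_rotation0 (L := mulmx p.2) p.1 (@continuous_mulmx _ _ _ _)
  (rotation_curve_smooth s x).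
by rewrite rotation_curve0 IH big_cons addrC.
Qed.

Lemma rotation_curve_focal s x t :
  (forall p, List.In p s -> focal_rotation P p.2) -> focal P x ->
  focal P (rotation_curve s x t).
Proof.
move=> + Fx; elim: s => [//|p s IH] rot /=.
apply: (rot p (or_introl erefl)); first exact: cos2Dsin2.
by apply: IH => q qs; apply: rot; right.
Qed.

Lemma focal_curve x X : focal P x -> focal_tangent P x X ->
  exists g : R -> 'cV[R]_8,
    [/\ smooth g, forall t, focal P (g t), g 0 = x & 'D_1 g 0 = X].
Proof.
move=> Fx TX; have [U [P0U UU]] := clifford_basis hP.
pose B k := hat U (P 1 *m U) (quat k).
(* The angular velocities are the coefficients in [focal_tangent_casimir], so the velocity at 0 is
   X. *)
pose s := (- dot (eta P x) X, P 0 *m P 1)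
  :: [seq (dot (B k *m x) X, B k) | k <- index_enum 'I_6].
exists (rotation_curve s x); split.
- exact: rotation_curve_smooth.
- move=> t; apply: rotation_curve_focal => // p /=.
  case=> [<-|]; first exact: (eta_rotation hP P0U erefl UU).
  elim: (index_enum _) => //= k r IH [<-|/IH//] /=.
  exact: (hat_rotation hP P0U erefl UU).
- exact: rotation_curve0.
rewrite rotation_curve_velocity big_cons big_map /=.
by rewrite [RHS](focal_tangent_casimir hP P0U erefl UU Fx TX) scaleNr addrC.
Qed.

Lemma tangent_spaceI (V : normedModType R) (S : set V) (g : R -> V) :
  smooth g -> (forall t, S (g t)) -> tangent_space S (g 0) ('D_1 g 0).
Proof.
move=> sg Sg; exists 1, g; split=> //; first exact: smooth_onS.
by rewrite derive1E.
Qed.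

Lemma derive_eventually_cst (V : normedModType R) (f : R -> V) (d : R) (c : V) :
  0 < d -> (forall t, - d < t < d -> f t = c) -> 'D_1 f 0 = 0.
Proof.
move=> d0 fc; rewrite -[RHS](derive_cst c (0 : R) 1); apply: near_eq_derive.
apply/nbhs_ballP; exists d => // t; rewrite /ball /= sub0r normrN ltr_norml.
exact: fc.
Qed.

Lemma smooth_on_differentiable0 (V : normedModType R) (d : R) (g : R -> V) :
  0 < d -> smooth_on (`]- d, d[%classic : set R) g -> differentiable g 0.
Proof.
move=> d0 /(_ 1%N)[dg _]; apply: dg => /=.
by rewrite in_itv /= oppr_lt0 d0.
Qed.

Lemma focal_tangent_necessary (g : R -> 'cV[R]_8) (d : R) :
  0 < d -> differentiable g 0 -> (forall t, - d < t < d -> focal P (g t)) ->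
  focal_tangent P (g 0) ('D_1 g 0).
Proof.
move=> d0 dg Fg.
(* All three equations have the form Mx.x = c with [M] symmetric ([1], [P 0] or [P 1]);
   differentiating gives 2 Mx.x' = 0. *)
have quad (M : 'M[R]_8) c : M^T = M ->
    (forall t, - d < t < d -> dot (M *m g t) (g t) = c) ->
    dot (M *m g 0) ('D_1 g 0) = 0.
  move=> MT Mc; have cM := @continuous_mulmx R _ _ M.
  have dMg : differentiable (fun t => M *m g t) 0.
    apply: (differentiable_comp (g := mulmx M)) => //.
    exact: linear_differentiable.
  have [_ /(_ 1)] := is_diff_dot dMg dg.
  rewrite (derive_eventually_cst d0 Mc).
  rewrite (derive_linear_comp (L := mulmx M) _ cM dg).
  by rewrite dot_mulmxl MT dotC /=; lra.
split.
- rewrite -[g 0 in X in dot X]mul1mx; apply: (quad _ 1); first exact: trmx1.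
  by move=> t /Fg[+ _ _]; rewrite mul1mx.
- by apply: (quad _ 0) => [|t /Fg[]//]; exact: clifford_sym.
- by apply: (quad _ 0) => [|t /Fg[]//]; exact: clifford_sym.
Qed.

Lemma tangent_focalE x X : focal P x ->
  tangent_space (focal P) x X <-> focal_tangent P x X.
Proof.
move=> Fx; split=> [[d [g [d0 sg Fg <- <-]]]|TX].
  rewrite derive1E; apply: (focal_tangent_necessary d0) => //.
  exact: smooth_on_differentiable0 sg.
by have [g [sg Fg <- <-]] := focal_curve Fx TX; exact: tangent_spaceI.
Qed.

Lemma circle_orthogonal (a w : R * R) : circle a -> a.1 * w.1 + a.2 * w.2 = 0 ->
  w = (a.1 * w.2 - a.2 * w.1) *: eps a.
Proof.
case: a w => a1 a2 [w1 w2]; rewrite /circle /= => aa aw.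
(* Multiples of the orthogonality relation and of |a|^2 = 1 make the two coordinate goals linear in
   the monomials. *)
have hw b : b * (a1 * w1 + a2 * w2) = 0 by rewrite aw mulr0.
have ha b : b * (a1 ^+ 2 + a2 ^+ 2) = b by rewrite aa mulr1.
have := (hw a1, hw a2, ha w1, ha w2) => -[[[h1 h2] h3] h4].
by congr pair; rewrite /GRing.scale /=; lra.
Qed.

Lemma is_diff_fst (V W X : normedModType R) (f : V -> W * X) x :
  differentiable f x -> differentiable (fun y => (f y).1) x /\
  forall v, 'D_v (fun y => (f y).1) x = ('D_v f x).1.
Proof.
move=> df; have cL : continuous (fst : W * X -> W) by move=> ?; exact: cvg_fst.
split=> [|v]; last exact: (derive_linear_comp (L := fst) _ cL df).
by apply: (differentiable_comp (g := fst)) => //; exact: linear_differentiable.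
Qed.

Lemma is_diff_snd (V W X : normedModType R) (f : V -> W * X) x :
  differentiable f x -> differentiable (fun y => (f y).2) x /\
  forall v, 'D_v (fun y => (f y).2) x = ('D_v f x).2.
Proof.
move=> df; have cL : continuous (snd : W * X -> X) by move=> ?; exact: cvg_snd.
split=> [|v]; last exact: (derive_linear_comp (L := snd) _ cL df).
by apply: (differentiable_comp (g := snd)) => //; exact: linear_differentiable.
Qed.

Lemma smooth_fst (V W X : normedModType R) (f : V -> W * X) :
  smooth f -> smooth (fun x => (f x).1).
Proof. by apply: (smooth_linear_comp (L := fst)) => ?; exact: cvg_fst. Qed.

Lemma smooth_snd (V W X : normedModType R) (f : V -> W * X) :
  smooth f -> smooth (fun x => (f x).2).
Proof. by apply: (smooth_linear_comp (L := snd)) => ?; exact: cvg_snd. Qed.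

Lemma circle_tangent_necessary (g : R -> R * R) (d : R) :
  0 < d -> differentiable g 0 -> (forall t, - d < t < d -> circle (g t)) ->
  (g 0).1 * ('D_1 g 0).1 + (g 0).2 * ('D_1 g 0).2 = 0.
Proof.
move=> d0 dg Cg; have [d1 D1] := is_diff_fst dg; have [d2 D2] := is_diff_snd dg.
have [dp1 Dp1] := is_diff_scale d1 d1; have [dp2 Dp2] := is_diff_scale d2 d2.
pose q t : R := (g t).1 *: (g t).1 + (g t).2 *: (g t).2.
have : 'D_1 q 0 = 0.
  exact: (@derive_eventually_cst R q d (1 : R) d0 Cg).
rewrite deriveD ?Dp1 ?Dp2 ?D1 ?D2; [|exact: diff_derivable..].
by rewrite /GRing.scale /=; lra.
Qed.

Lemma circle_curve (a : R * R) (c : R) : circle a ->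
  exists g : R -> R * R,
    [/\ smooth g, forall t, circle (g t), g 0 = a & 'D_1 g 0 = c *: eps a].
Proof.
move=> Ca; pose L := fun w : R * R => eps w.
have lin : linear L.
  move=> k [u1 u2] [v1 v2]; rewrite /L /eps /=.
  by congr pair; rewrite /= ?opprD ?scalerN.
pose epsL : {linear (R * R)%type -> (R * R)%type} :=
  HB.pack L (GRing.isLinear.Build _ _ _ _ _ lin).
have cL : continuous epsL.
  apply: smooth_continuous; apply: smooth_pair; last exact/smooth_fst/smooth_id.
  exact/smooth_opp/smooth_snd/smooth_id.
exists (fun t => cos (c * t) *: a + sin (c * t) *: epsL a); split.
- exact: (smooth_rotation (L := epsL) _ cL (smooth_cst _ _)).
- move=> t; rewrite /circle /= /GRing.scale /=; case: a Ca => a1 a2 /=.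
  rewrite /circle /= => aa; have cs := cos2Dsin2 (c * t).
  by rewrite -[RHS]mulr1 -{1}cs -aa; ring.
- by rewrite mulr0 cos0 sin0 scale1r scale0r addr0.
- rewrite (derive_rotation0 (L := epsL) _ cL (smooth_cst _ _)).
  by rewrite derive_cst add0r.
Qed.

(** Projecting a curve to the factors gives the necessary conditions; pairing a rotation of the
    circle with a focal curve realizes every candidate. *)
Lemma tangent_circle_focalE (a : R * R) x (v : @ambient R) :
  circle_focal P (a, x) ->
  tangent_space (circle_focal P) (a, x) v <->
  (exists c, v.1 = c *: eps a) /\ focal_tangent P x v.2.
Proof.
move=> [/= Ca Fx]; split.
  move=> [d [g [d0 sg Fg g0 <-]]]; rewrite derive1E.
  have dg := smooth_on_differentiable0 d0 sg.
  have [d1 /(_ 1) <-] := is_diff_fst dg; have [d2 /(_ 1) <-] := is_diff_snd dg.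
  split.
    have -> : a = (g 0).1 by rewrite g0.
    eexists; apply: circle_orthogonal; first by rewrite g0.
    by apply: circle_tangent_necessary d0 d1 _ => t /Fg[].
  have -> : x = (g 0).2 by rewrite g0.
  by apply: focal_tangent_necessary d0 d2 _ => t /Fg[].
case: v => v1 v2 /= -[[c ->] TX].
have [g [sg Fg g0 <-]] := focal_curve Fx TX.
have [h [sh Ch h0 <-]] := circle_curve c Ca.
rewrite -derive_pair; [|exact: smooth_differentiable..].
rewrite -g0 -h0; apply: (tangent_spaceI (g := fun t => (h t, g t))).
  exact: smooth_pair.
by move=> t; split; [exact: Ch | exact: Fg].
Qed.

End FocalTangent.

(** * The orthonormal U-frame *)

Section ProductFrame.
Context {R : realType} (P : 'I_2 -> 'M[R]_8).
Hypothesis hP : symmetric_clifford_system P.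
Variables U W : 'M[R]_(8, 4).
Hypotheses (P0U : P 0 *m U = U) (P1U : P 1 *m U = W) (UU : U^T *m U = 1%:M).
Local Notation smooth := (smooth_on setT).

Lemma smooth_focal_field j : smooth (focal_field U W j).
Proof.
have sC V : smooth (focal_coord V).
  by apply: smooth_scale; [exact: smooth_cst | exact: smooth_mulmx].
have sq k : smooth (fun x => quat k *m focal_coord U x) by exact: smooth_mulmx_comp.
have sm : smooth (fun x => dot (quat 2 *m focal_coord U x) (focal_coord W x)).
  exact: smooth_dot.
have sc : smooth (fun x => refl_coef (focal_coord W x) (quat 2 *m focal_coord U x)
    (fun k : 'I_2 => quat (widen_ord (isT : 2 <= 6)%N k) *m focal_coord U x) j).
  apply: smooth_mul; first exact: smooth_dot.
  apply: smooth_inv => [x|]; first exact: refl_denom_neq0.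
  by apply: smooth_add; [exact: smooth_cst | exact: smooth_mul].
apply: smooth_add; apply: smooth_mulmx_comp.
  apply: smooth_sub => //; apply: smooth_scale => //.
  by apply: smooth_add => //; exact: smooth_scale.
apply: smooth_scale; first exact: smooth_opp.
by apply: smooth_sub => //; exact: smooth_scale.
Qed.

(** The order fits [J0]: frame vectors 1, 2 lie in V, 3 is [eta] = J [eps], and 4, 5 are J of 1, 2.
    The entry at 0, where the frame is [eps], keeps the map injective. *)
Definition frame_index (i : 'I_6) : 'I_8 :=
  nth ord0 [:: ord0; @Ordinal 8 4 isT; @Ordinal 8 5 isT; @Ordinal 8 3 isT;
               @Ordinal 8 6 isT; @Ordinal 8 7 isT] i.

Definition focal_frame (i : 'I_(3 + 3)) (p : @ambient R) : @ambient R :=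
  if i == 0 then (eps p.1, 0) else (0, focal_basis P U W p.2 (frame_index i)).

Lemma focal_frame_smooth i : smooth (focal_frame i).
Proof.
have c2 : continuous (snd : @ambient R -> 'cV[R]_8) by move=> ?; exact: cvg_snd.
have s1 : smooth (fun p : @ambient R => p.1) by exact/smooth_fst/smooth_id.
have s2 : smooth (fun p : @ambient R => p.2) by exact/smooth_snd/smooth_id.
have sf j : smooth (fun p : @ambient R => focal_field U W j p.2).
  exact: (smooth_comp_linear (L := snd) c2 (smooth_focal_field j)).
case: i => [[|i] lti]; rewrite /focal_frame /=.
  apply: smooth_pair; last exact: smooth_cst.
  by apply: smooth_pair; [exact/smooth_opp/smooth_snd | exact: smooth_fst].
apply: smooth_pair; first exact: smooth_cst.
by case: i lti => [|[|[|[|[|?]]]]] lti //;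
  by rewrite /focal_basis /=; try apply: smooth_mulmx_comp;
    first [exact: sf | exact: s2].
Qed.

Lemma frame_index_inj : injective frame_index.
Proof.
move=> i j /(congr1 val) ij; apply: val_inj; move: ij.
by case: i j => [[|[|[|[|[|[|?]]]]]] ?] [[|[|[|[|[|[|?]]]]]] ?].
Qed.

Lemma focal_frame_orthonormal p i j : circle_focal P p ->
  ambient_dot (focal_frame i p) (focal_frame j p) = (i == j)%:R.
Proof.
case: p => a x [/= Ca Fx]; rewrite /ambient_dot /focal_frame.
case: ifPn => i0; case: ifPn => j0.
- rewrite (eqP i0) (eqP j0) eqxx /= dot0l addr0 mulrNN -!expr2 addrC; exact: Ca.
- by rewrite (eqP i0) [0 == j]eq_sym (negPf j0) /= !mulr0 add0r dot0l addr0.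
- by rewrite (eqP j0) (negPf i0) /= !mul0r add0r dotC dot0l addr0.
- by rewrite /= !mul0r !add0r focal_basis_orthonormal // (inj_eq frame_index_inj).
Qed.

Lemma focal_frame_tangent p i : circle_focal P p ->
  tangent_space (circle_focal P) p (focal_frame i p).
Proof.
case: p => a x Cp; have [/= Ca Fx] := Cp; apply/tangent_circle_focalE => //.
have ob := focal_basis_orthonormal hP P0U P1U UU _ _ Fx.
rewrite /focal_frame; case: ifPn => i0 /=.
  split; first by exists 1; rewrite scale1r.
  by split; rewrite dotC dot0l.
split; first by exists 0; rewrite scale0r.
split; [have := ob ord0 (frame_index i)
  | have := ob (@Ordinal 8 1 isT) (frame_index i)
  | have := ob (@Ordinal 8 2 isT) (frame_index i)]; rewrite {1}/focal_basis /= => ->.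
all: by case: i i0 => [[|[|[|[|[|[|?]]]]]] ?].
Qed.

Lemma focal_frame_expand p v : circle_focal P p ->
  tangent_space (circle_focal P) p v ->
  v = \sum_i ambient_dot v (focal_frame i p) *: focal_frame i p.
Proof.
case: p => a x Cp; have [/= Ca Fx] := Cp; move/(tangent_circle_focalE hP v Cp).
case: v => v1 v2 /= -[[c v1E] [T0 T1 T2]].
have ob i j := focal_basis_orthonormal hP P0U P1U UU i j Fx.
rewrite [RHS]surjective_pairing (linear_sum fst) (linear_sum snd) /=.
congr pair.
  rewrite big_ord_recl big1 => [|i _]; last by rewrite /= scaler0.
  rewrite addr0 /focal_frame /= /ambient_dot /= v1E /= /GRing.scale /=.
  rewrite dotC dot0l addr0.
  have -> : c * - a.2 * - a.2 + c * a.1 * a.1 = c.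
    rewrite -[RHS]mulr1 -Ca; ring.
  by [].
(* In the R^8 component, tangency kills the coefficients along the normal vectors [x], [P 0 *m x],
   [P 1 *m x]. *)
rewrite [LHS](dot_basis (b := focal_basis P U W x)) //.
rewrite !big_ord_recl !big_ord0 /ambient_dot /focal_frame /= !mulr0 !add0r.
rewrite /frame_index /focal_basis /= !(dotC v2) T0 T1 T2.
rewrite !scale0r !scaler0 !add0r !addr0 addrCA; congr (_ + _).
by rewrite addrCA.
Qed.

Variable J : @ambient R -> @ambient R -> @ambient R.
Hypothesis hJ : product_complex_structure P J.

Lemma eta_eta x : eta P (eta P x) = - x.
Proof.
rewrite /eta -!mulmxA (mulmxA (P 1) (P 0)) (clifford_anticomm hP) mulNmx mulmxN.
rewrite -mulmxA (mulmxA (P 1)) (clifford_sqr hP) mul1mx.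
by rewrite mulmxA (clifford_sqr hP) mul1mx.
Qed.

Lemma focal_basis_complement x (i : 'I_8) : focal P x -> (3 < i)%N ->
  eta_complement P x (focal_basis P U W x i).
Proof.
move=> Fx i3; have ob := focal_basis_orthonormal hP P0U P1U UU _ _ Fx.
have ne k (ltk : (k < 8)%N) : (k <= 3)%N -> (Ordinal ltk == i) = false.
  by move=> k3; apply/negP => /eqP ki; rewrite -ki /= ltnNge k3 in i3.
split.
  apply/tangent_focalE => //; split;
    [have := ob (@Ordinal 8 0 isT) i | have := ob (@Ordinal 8 1 isT) i
    |have := ob (@Ordinal 8 2 isT) i]; by rewrite {1}/focal_basis /= ne.
by have := ob (@Ordinal 8 3 isT) i; rewrite {1}/focal_basis /= ne // dotC.
Qed.

(** For k = 0 the pair is ([eps], [eta]); for k = 1, 2 it is a vector of V and its image under P_0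
    P_1, whose square is -1 by [eta_eta]. *)
Lemma J_focal_frame p (k : 'I_3) : circle_focal P p ->
  J p (focal_frame (lshift 3 k) p) = focal_frame (rshift 3 k) p /\
  J p (focal_frame (rshift 3 k) p) = - focal_frame (lshift 3 k) p.
Proof.
case: p => a x Cp; have [/= Ca Fx] := Cp; have [_ J1 J2 J3] := hJ Cp.
have cpl := focal_basis_complement Fx.
have oppE (u : R * R) (X : 'cV[R]_8) : - ((u, X) : @ambient R) = (- u, - X) by [].
case: k => [[|[|[|//]]] ltk]; rewrite /focal_frame /=.
- rewrite J1; split=> //; rewrite /focal_basis /= J2.
  by rewrite oppE oppr0.
- rewrite !J3; try exact: cpl.
  rewrite /focal_basis /= -!/(eta P _) eta_eta; by rewrite oppE oppr0.
- rewrite !J3; try exact: cpl.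
  rewrite /focal_basis /= -!/(eta P _) eta_eta; by rewrite oppE oppr0.
Qed.

Lemma sum_J0 n (f : 'I_(n + n) -> @ambient R) (k : 'I_n) :
  \sum_i J0 n i (lshift n k) *: f i = f (rshift n k) /\
  \sum_i J0 n i (rshift n k) *: f i = - f (lshift n k).
Proof.
rewrite !big_split_ord /=; split.
  rewrite big1 => [|i _]; last by rewrite block_mxEul mxE scale0r.
  rewrite add0r (bigD1 k) //= big1 => [|i ik].
    by rewrite addr0 block_mxEdl !mxE eqxx scale1r.
  by rewrite block_mxEdl !mxE (negPf ik) scale0r.
rewrite addrC big1 => [|i _]; last by rewrite block_mxEdr mxE scale0r.
rewrite add0r (bigD1 k) //= big1 => [|i ik].
  by rewrite addr0 block_mxEur !mxE eqxx scaleN1r.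
by rewrite block_mxEur !mxE (negPf ik) oppr0 scale0r.
Qed.

Lemma ambient_dot_suml n (c : 'I_n -> R) (f : 'I_n -> @ambient R) w :
  ambient_dot (\sum_i c i *: f i) w = \sum_i c i * ambient_dot (f i) w.
Proof.
rewrite /ambient_dot (linear_sum fst) (linear_sum snd) /= (linear_sum fst) /=.
rewrite (linear_sum snd) /= dot_suml !mulr_suml -!big_split; apply: eq_bigr => i _.
by rewrite /= /GRing.scale /= dotZl; ring.
Qed.

Lemma focal_frame_coord p c j : circle_focal P p ->
  ambient_dot (\sum_i c i *: focal_frame i p) (focal_frame j p) = c j.
Proof.
move=> Cp; rewrite ambient_dot_suml (bigD1 j) //= big1 => [|i ij].
  by rewrite focal_frame_orthonormal // eqxx mulr1 addr0.
by rewrite focal_frame_orthonormal // (negPf ij) mulr0.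
Qed.

Lemma focal_U_frame : U_frame P J focal_frame /\ orthonormal_frame P focal_frame.
Proof.
split; last by move=> p i j; exact: focal_frame_orthonormal.
split; last first.
  move=> p j Cp; case: (split_ordP j) => k ->.
    by rewrite (J_focal_frame k Cp).1 (sum_J0 (focal_frame ^~ p) k).1.
  by rewrite (J_focal_frame k Cp).2 (sum_J0 (focal_frame ^~ p) k).2.
split.
- move=> i p Cp; exists setT, (focal_frame i); split=> //; first exact: openT.
  exact: focal_frame_smooth.
- by move=> i p; exact: focal_frame_tangent.
- move=> p v Cp Tv.
  exists (\col_i ambient_dot v (focal_frame i p)); split.
    rewrite {1}(focal_frame_expand Cp Tv).
    by apply: eq_bigr => i _; rewrite mxE.
  move=> c ->; apply/colP => i.
  by rewrite mxE (focal_frame_coord (c ^~ 0) i Cp).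
Qed.

End ProductFrame.

(** * First Chern class *)

Section ComplexLogarithm.
Context {R : realType}.
Implicit Types z w : R[i].

Lemma cexpD z w : cexp (z + w) = cexp z * cexp w.
Proof.
case: z w => [a b] [c d]; rewrite /cexp /= expRD cosD sinD.
by simpc; congr Complex; ring.
Qed.

Lemma cexp0 : cexp 0 = 1 :> R[i].
Proof. by rewrite /cexp /= expR0 cos0 sin0; simpc. Qed.

Lemma cexpN z : cexp (- z) * cexp z = 1.
Proof. by rewrite -cexpD addNr cexp0. Qed.

(* The principal logarithm; only meaningful on the right half-plane. *)
Definition clog z : R[i] :=
  ln (Num.sqrt (complex.Re z ^+ 2 + complex.Im z ^+ 2))
    +i* atan (complex.Im z / complex.Re z).

Lemma cexp_clog z : 0 < complex.Re z -> cexp (clog z) = z.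
Proof.
case: z => [x y] /= x0; rewrite /cexp /clog /=.
have r0 : 0 < Num.sqrt (x ^+ 2 + y ^+ 2).
  by rewrite sqrtr_gt0 ltr_pwDl ?exprn_gt0 // sqr_ge0.
(* As x > 0, the modulus of z is x sqrt(1 + (y/x)^2), which matches cos(atan t) = 1 / sqrt(1 +
   t^2). *)
have E : Num.sqrt (1 + (y / x) ^+ 2) = Num.sqrt (x ^+ 2 + y ^+ 2) / x.
  have -> : 1 + (y / x) ^+ 2 = (x ^+ 2 + y ^+ 2) * x ^- 2.
    by field; rewrite gt_eqF.
  rewrite sqrtrM ?addr_ge0 ?sqr_ge0 // -exprVn sqrtr_sqr gtr0_norm //.
  by rewrite invr_gt0.
have sE : sin (atan (y / x)) = y / x * cos (atan (y / x)).
  have cn0 : cos (atan (y / x)) != 0.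
    by rewrite cos_atan invr_eq0 E mulf_neq0 ?invr_eq0 ?gt_eqF.
  by apply: (mulIf (invr_neq0 cn0)); rewrite mulfK //; exact: atanK.
rewrite lnK ?posrE // sE cos_atan E; simpc.
by congr Complex; field; rewrite ?gt_eqF.
Qed.

(** At most three multiplications by i = exp(i pi/2) bring a nonzero number into the right
    half-plane, where [clog] applies. *)
Lemma cexp_surj z : z != 0 -> exists w, cexp w = z.
Proof.
have ci : cexp (0 +i* (pi / 2)) = 'i%C :> R[i].
  by rewrite /cexp /= expR0 cos_pihalf sin_pihalf; simpc.
have step w : (exists v, cexp v = 'i%C * w) -> exists v, cexp v = w.
  move=> [v vw]; exists (v - (0 +i* (pi / 2))).
  have := cexpN (0 +i* (pi / 2)); rewrite cexpD vw ci => h.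
  by rewrite mulrC mulrA h mul1r.
have pos w : 0 < complex.Re w -> exists v, cexp v = w.
  by move=> w0; exists (clog w); exact: cexp_clog.
case: z => [x y] z0; have [x0|x0|x0] := ltrgtP x 0.
- by apply/step/step/pos => /=; simpc; rewrite oppr_gt0.
- exact: pos.
- have [y0|y0|y0] := ltrgtP y 0.
  + by apply/step/pos => /=; simpc; rewrite oppr_gt0.
  + by apply/step/step/step/pos; simpc.
  + by rewrite x0 y0 eqxx in z0.
Qed.

Lemma cos_eq1 (b : R) : cos b = 1 -> exists k : int, b = (2 * pi) * k%:~R.
Proof.
have pi2 : 0 < 2 * pi :> R by rewrite mulr_gt0 // pi_gt0.
pose k := Num.floor (b / (2 * pi)); pose c := b - (2 * pi) * k%:~R.
have cosk (m : int) (t : R) : cos (t + (2 * pi) * m%:~R) = cos t.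
  have P2 n u : cos (u + (2 * pi) * n%:R) = cos u :> R.
    by rewrite mulr_natr mulr_natl; exact: (periodicn (@cosD2pi R)).
  case: m => n; first exact: P2.
  by rewrite -(P2 n.+1 (t + _)) -addrA -mulrDr NegzE mulrNz addNr mulr0 addr0.
move=> b1; have c1 : cos c = 1.
  by rewrite -b1 -(cosk (- k) b) mulrNz mulrN.
have [c0 c2] : 0 <= c /\ c < 2 * pi.
  have /andP[] := floor_itv (b / (2 * pi)); rewrite -/k.
  rewrite ler_pdivlMr // ltr_pdivrMr // intrD mulrDl mul1r /c => h1 h2.
  by split; lra.
exists k; suff : c = 0 by move/eqP; rewrite subr_eq0 => /eqP.
have p0 := @pi_gt0 R.
(* Injectivity of cos on [0, pi] applies to [c], or else to [2 * pi - c], which would vanish against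
   c < 2 pi. *)
have [cpi|cpi] := leP c pi.
  by apply: (@cos_inj R); rewrite ?in_itv /= ?lexx ?c0 ?cpi ?ltW ?cos0.
have : 2 * pi - c = 0.
  apply: (@cos_inj R); rewrite ?in_itv /= ?lexx ?(ltW p0) //=; last first.
    by have := cosk 1 (- c); rewrite cosN c1 mulr1 addrC cos0.
  by apply/andP; split; lra.
by lra.
Qed.

(** Exactness of the exponential sequence at C: the modulus exp(-2 pi y) = 1 forces y = 0, and then
    2 pi x is a multiple of 2 pi. *)
Lemma cexp_eq1 z : cexp ((0 +i* (2 * pi)) * z) = 1 -> exists k : int, z = k%:~R.
Proof.
case: z => [x y]; simpc; rewrite /cexp /=; simpc => -[].
set r := expR _; set t := 2 * pi * x => h1 h2.
have r0 : 0 < r by exact: expR_gt0.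
have r1 : r = 1.
  have : r ^+ 2 = 1.
    have : (r * cos t) ^+ 2 + (r * sin t) ^+ 2 = r ^+ 2.
      by rewrite !exprMn -mulrDr cos2Dsin2 mulr1.
    by rewrite h1 h2 => <-; ring.
  by move/eqP; rewrite sqrf_eq1 => /orP[/eqP //|/eqP rN]; move: r0; rewrite rN; lra.
have y0 : y = 0.
  have : - (2 * pi * y) = 0 by apply: (@expR_inj R); rewrite expR0.
  move/eqP; rewrite oppr_eq0 !mulf_eq0 pnatr_eq0 /= (gt_eqF (@pi_gt0 R)) /=.
  by move/eqP.
have [k tk] : exists k : int, t = (2 * pi) * k%:~R.
  by apply: cos_eq1; rewrite -h1 r1 mul1r.
exists k; rewrite -(rmorph_int (real_complex R)) y0; congr Complex.
by apply: (mulfI _ tk); rewrite mulf_neq0 // gt_eqF // pi_gt0.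
Qed.

End ComplexLogarithm.

(** * Continuous complex-valued functions on a subset *)

Section ContinuousC.
Context {R : realType} {B : topologicalType}.
Implicit Types (D : set B) (f g : B -> R[i]).

Lemma continuousC_onP D f : continuousC_on D f <->
  (forall q, D q ->
    (fun p => complex.Re (f p)) @ within D (nbhs q) --> complex.Re (f q)) /\
  (forall q, D q ->
    (fun p => complex.Im (f p)) @ within D (nbhs q) --> complex.Im (f q)).
Proof.
by split=> -[fr fi]; split; apply/subspace_continuousP.
Qed.

Lemma continuousC_onW D D' f : D' `<=` D ->
  continuousC_on D f -> continuousC_on D' f.
Proof.
move=> DD [fr fi]; split; first exact: continuous_subspaceW fr.
exact: continuous_subspaceW fi. Qed.

Lemma continuousC_on_cst D (c : R[i]) : continuousC_on D (fun=> c).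
Proof. by apply/continuousC_onP; split=> q _; exact: cvg_cst. Qed.

Lemma continuousC_onD D f g : continuousC_on D f -> continuousC_on D g ->
  continuousC_on D (fun q => f q + g q).
Proof.
move=> /continuousC_onP[fr fi] /continuousC_onP[gr gi].
have E p : f p + g p = (complex.Re (f p) + complex.Re (g p)) +i*
    (complex.Im (f p) + complex.Im (g p)).
  by case: (f p) (g p) => [? ?] [? ?].
apply/continuousC_onP; split=> q Dq; rewrite E /=; under eq_fun do rewrite E /=.
  by apply: cvgD; [exact: fr | exact: gr].
by apply: cvgD; [exact: fi | exact: gi].
Qed.

Lemma continuousC_onM D f g : continuousC_on D f -> continuousC_on D g ->
  continuousC_on D (fun q => f q * g q).
Proof.
move=> /continuousC_onP[fr fi] /continuousC_onP[gr gi].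
have E p : f p * g p =
    (complex.Re (f p) * complex.Re (g p) - complex.Im (f p) * complex.Im (g p)) +i*
    (complex.Re (f p) * complex.Im (g p) + complex.Im (f p) * complex.Re (g p)).
  by case: (f p) (g p) => [? ?] [? ?].
apply/continuousC_onP; split=> q Dq; rewrite E /=; under eq_fun do rewrite E /=.
  by apply: cvgB; apply: cvgM; [exact: fr | exact: gr | exact: fi | exact: gi].
by apply: cvgD; apply: cvgM; [exact: fr | exact: gi | exact: fi | exact: gr].
Qed.

Lemma continuousC_onB D f g : continuousC_on D f -> continuousC_on D g ->
  continuousC_on D (fun q => f q - g q).
Proof.
move=> fc gc; have -> : (fun q => f q - g q) = (fun q => f q + (-1) * g q).
  by apply/funext => q; rewrite mulN1r.
apply: continuousC_onD => //; apply: continuousC_onM => //.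
exact: continuousC_on_cst.
Qed.

Lemma continuousC_on_det D n (h : B -> 'M[R[i]]_n) :
  (forall i j, continuousC_on D (fun q => h q i j)) ->
  continuousC_on D (fun q => \det (h q)).
Proof.
move=> hc; have sumc (I : Type) (r : seq I) (F : I -> B -> R[i]) :
    (forall i, continuousC_on D (F i)) ->
    continuousC_on D (fun q => \sum_(i <- r) F i q).
  move=> Fc; elim: r => [|i r IH].
    by under eq_fun do rewrite big_nil; exact: continuousC_on_cst.
  by under eq_fun do rewrite big_cons; exact: continuousC_onD.
have prodc (I : Type) (r : seq I) (F : I -> B -> R[i]) :
    (forall i, continuousC_on D (F i)) ->
    continuousC_on D (fun q => \prod_(i <- r) F i q).
  move=> Fc; elim: r => [|i r IH].
    by under eq_fun do rewrite big_nil; exact: continuousC_on_cst.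
  by under eq_fun do rewrite big_cons; exact: continuousC_onM.
apply: sumc => s; apply: continuousC_onM; first exact: continuousC_on_cst.
exact: prodc.
Qed.

Lemma continuousC_on_clog D f : (forall q, D q -> 0 < complex.Re (f q)) ->
  continuousC_on D f -> continuousC_on D (fun q => clog (f q)).
Proof.
move=> f0 /continuousC_onP[fr fi]; apply/continuousC_onP; split=> q Dq /=.
  apply: (cvg_comp _ (ln (R := R))); last first.
    apply: continuous_ln; rewrite sqrtr_gt0 ltr_pwDl ?sqr_ge0 // exprn_gt0 //.
    exact: f0.
  apply: (cvg_comp _ Num.sqrt); last exact: sqrt_continuous.
  exact: (cvgD (cvgM (fr q Dq) (fr q Dq)) (cvgM (fi q Dq) (fi q Dq))).
apply: (cvg_comp _ (atan (R := R))); last exact: continuous_atan.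
apply: cvgM; first exact: fi.
by apply: cvgV; [rewrite gt_eqF // f0 | exact: fr].
Qed.

(** Near [x] the quotient f / f(x) is close to 1, hence in the right half-plane; its principal
    logarithm plus a logarithm of f(x), divided by 2 pi i, is the required function. *)
Lemma local_clog D f x : D x -> f x != 0 -> continuousC_on D f ->
  exists (N : set B) (l : B -> R[i]), [/\ open N, N x, continuousC_on (N `&` D) l &
    forall q, (N `&` D) q -> cexp ((0 +i* (2 * pi)) * l q) = f q].
Proof.
move=> Dx fx0 fc; have [c cE] := cexp_surj fx0.
pose F q := f q * (f x)^-1.
have Fc : continuousC_on D F.
  by apply: continuousC_onM => //; exact: continuousC_on_cst.
have Fx : F x = 1 by rewrite /F divff.
have : \forall q \near within D (nbhs x), 0 < complex.Re (F q).
  have [/(_ x Dx) Fr _] := (continuousC_onP D F).1 Fc.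
  by apply: (cvgr_gt _ Fr); rewrite Fx /= ltr01.
rewrite near_withinE nbhsE => -[N [oN Nx] NF].
pose k : R[i] := 0 +i* (2 * pi).
have k0 : k != 0 by rewrite eq_complex /= eqxx /= mulf_neq0 // gt_eqF // pi_gt0.
exists N, (fun q => k^-1 * (clog (F q) + c)); split=> //.
  apply: continuousC_onM; first exact: continuousC_on_cst.
  apply: continuousC_onD; last exact: continuousC_on_cst.
  apply: continuousC_on_clog => [q [Nq Dq]|]; first exact: NF.
  by apply: continuousC_onW Fc => q [].
move=> q [Nq Dq]; rewrite mulVKf // cexpD cE cexp_clog; last exact: NF.
by rewrite /F mulfVK.
Qed.

(** By continuity, nearby values are integers at distance less than 1, hence equal. *)
Lemma integral_locally_constant D f (c : B -> int) :
  continuousC_on D f -> (forall q, D q -> f q = (c q)%:~R) -> locally_constant D c.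
Proof.
move=> /continuousC_onP[fr _] fE q Dq.
have Re_int (m : int) : complex.Re (m%:~R : R[i]) = m%:~R.
  by rewrite -(rmorph_int (real_complex R)).
have := fr q Dq; rewrite fE // Re_int => /cvgrPdist_lt /(_ 1 ltr01).
rewrite !near_withinE; apply: filterS => p pc Dp; have := pc Dp.
rewrite fE // Re_int -intrB -intr_norm.
rewrite -[1]/(1%:~R) ltr_int => cqp; apply/esym/eqP; rewrite -subr_eq0.
by apply/negPn/negP; rewrite -normr_gt0 gtz0_ge1 leNgt cqp.
Qed.

End ContinuousC.

(** * Transitivity of cohomology between Cech cocycles *)

Section Cohomologous.
Context {B : topologicalType} {S : set B}.

Lemma locally_constantD (D : set B) (b b' : B -> int) :
  locally_constant D b -> locally_constant D b' ->
  locally_constant D (fun q => b q + b' q).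
Proof.
move=> lb lb' q Dq; near=> p; congr (_ + _).
  by near: p; exact: lb.
by near: p; exact: lb'.
Unshelve. all: by end_near. Qed.

Lemma locally_constantN (D : set B) (b : B -> int) :
  locally_constant D b -> locally_constant D (fun q => - b q).
Proof. by move=> lb q Dq; apply: filterS (lb q Dq) => p ->. Qed.

Lemma locally_constantW (D D' : set B) (b : B -> int) : D' `<=` D ->
  locally_constant D b -> locally_constant D' b.
Proof.
move=> DD lb q Dq; have := lb q (DD q Dq); rewrite !near_withinE.
by apply: filterS => p pb Dp; exact/pb/DD.
Qed.

(** On the intersections of the two covers, the bounding cochains add. *)
Lemma cohomologous_trans (c d e : cech_cocycle2 S) :
  cohomologous c d -> cohomologous d e -> cohomologous c e.
Proof.
move=> [W [b [Wc bl bE]]] [W' [b' [Wc' bl' bE']]].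
have oI x : S x -> open (W x `&` W' x).
  by move=> Sx; apply: openI; exact: nbhd_open.
have mI x : S x -> (W x `&` W' x) x by move=> Sx; split; exact: nbhd_mem.
exists (PointCover oI mI), (fun x y q => b x y q + b' x y q); split=> /=.
- by move=> x Sx q [/(Wc x Sx)[? _] /(Wc' x Sx)[_ ?]].
- move=> x y Sx Sy; apply: locally_constantD.
    by apply: locally_constantW (bl x y Sx Sy) => q [[[? _] [? _]] ?].
  by apply: locally_constantW (bl' x y Sx Sy) => q [[[_ ?] [_ ?]] ?].
- move=> x y z Sx Sy Sz q [[[[Wx Wx'] [Wy Wy']] [Wz Wz']] Sq].
  have h1 := bE x y z Sx Sy Sz q (conj (conj (conj Wx Wy) Wz) Sq).
  have h2 := bE' x y z Sx Sy Sz q (conj (conj (conj Wx' Wy') Wz') Sq).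
  by rewrite -[LHS](subrKA (coval d x y z q)) h1 h2; ring.
Qed.

End Cohomologous.

(** * Complex bundles with a global frame have vanishing first Chern class *)

Section GlobalFrame.
Context {R : realType} {B : topologicalType} {S : set B} {E : normedModType R}.
Context {n : nat} {T : B -> set E} {J : B -> E -> E}.
Local Notation scale := (complex_scale J).

Hypothesis T0 : forall q, S q -> T q 0.
Hypothesis T_lin : forall q (c : R) v w, S q -> T q v -> T q w -> T q (c *: v + w).
Hypothesis TJ : forall q v, S q -> T q v -> T q (J q v).
Hypothesis J_lin : forall q (c : R) v w, S q -> T q v -> T q w ->
  J q (c *: v + w) = c *: J q v + J q w.
Hypothesis JJ : forall q v, S q -> T q v -> J q (J q v) = - v.

Lemma T_scale q z v : S q -> T q v -> T q (scale q z v).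
Proof.
move=> Sq Tv; apply: T_lin => //; rewrite -[X in T q X]addr0.
by apply: T_lin; [| exact: TJ | exact: T0].
Qed.

Lemma T_sum q (I : Type) (r : seq I) (v : I -> E) : S q ->
  (forall i, T q (v i)) -> T q (\sum_(i <- r) v i).
Proof.
move=> Sq Tv; elim: r => [|i r IH]; first by rewrite big_nil; exact: T0.
by rewrite big_cons -[v i]scale1r; exact: T_lin.
Qed.

Lemma J_zero q : S q -> J q 0 = 0.
Proof.
move=> Sq; have := J_lin 1 Sq (T0 Sq) (T0 Sq).
by rewrite !scale1r addr0 => /eqP; rewrite -subr_eq subrr eq_sym => /eqP.
Qed.

Lemma J_add q v w : S q -> T q v -> T q w -> J q (v + w) = J q v + J q w.
Proof. by move=> Sq Tv Tw; have := J_lin 1 Sq Tv Tw; rewrite !scale1r. Qed.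

Lemma J_scale q (c : R) v : S q -> T q v -> J q (c *: v) = c *: J q v.
Proof.
by move=> Sq Tv; have := J_lin c Sq Tv (T0 Sq); rewrite J_zero // !addr0.
Qed.

Lemma complex_scaleDl q z w v : scale q (z + w) v = scale q z v + scale q w v.
Proof.
by case: z w => [a b] [c d]; rewrite /complex_scale /= !scalerDl addrACA.
Qed.

Lemma complex_scale_suml q (I : Type) (r : seq I) (z : I -> R[i]) v :
  scale q (\sum_(i <- r) z i) v = \sum_(i <- r) scale q (z i) v.
Proof.
elim: r => [|i r IH]; last by rewrite !big_cons complex_scaleDl IH.
by rewrite !big_nil /complex_scale /= !scale0r addr0.
Qed.

Lemma complex_scale0 q v : scale q 0 v = 0.
Proof. by rewrite /complex_scale /= !scale0r addr0. Qed.

Lemma complex_scale1 q v : scale q 1 v = v.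
Proof. by rewrite /complex_scale /= scale1r scale0r addr0. Qed.

Lemma complex_scaleDr q z v w : S q -> T q v -> T q w ->
  scale q z (v + w) = scale q z v + scale q z w.
Proof. by move=> Sq Tv Tw; rewrite /complex_scale J_add // !scalerDr addrACA. Qed.

Lemma complex_scale_sumr q (I : Type) (r : seq I) z (v : I -> E) : S q ->
  (forall i, T q (v i)) ->
  scale q z (\sum_(i <- r) v i) = \sum_(i <- r) scale q z (v i).
Proof.
move=> Sq Tv; elim: r => [|i r IH].
  by rewrite !big_nil /complex_scale J_zero // !scaler0 addr0.
by rewrite !big_cons complex_scaleDr ?IH //; exact: T_sum.
Qed.

Lemma complex_scaleA q z w v : S q -> T q v ->
  scale q z (scale q w v) = scale q (z * w) v.
Proof.
move=> Sq Tv; have TJv := TJ Sq Tv.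
have TZ (c : R) u : T q u -> T q (c *: u).
  by move=> Tu; rewrite -[_ *: _]addr0; apply: T_lin => //; exact: T0.
case: z w => [a b] [c d]; rewrite /complex_scale /=.
rewrite J_add ?J_scale ?JJ //; try exact: TZ.
rewrite !scalerDr !scalerA scalerN !scalerDl scaleNr.
by rewrite [X in _ + X = _]addrC addrACA.
Qed.

Definition transition (e s : 'I_n -> B -> E) q (h : 'M[R[i]]_n) : Prop :=
  forall j, s j q = \sum_k scale q (h k j) (e k q).

(** With frames as rows, s = e h and t = s g give t = e (h g). *)
Lemma transitionM D e s t q g h : D `<=` S -> D q ->
  complex_frame_on T J D e -> transition e s q h -> transition s t q g ->
  transition e t q (h *m g).
Proof.
move=> DS Dq [_ Te _] es st j; have Sq := DS q Dq.
transitivity (\sum_k \sum_i scale q (g k j * h i k) (e i q)).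
  rewrite st; apply: eq_bigr => k _.
  rewrite es complex_scale_sumr //; last first.
    by move=> i; apply: T_scale => //; exact: Te.
  by apply: eq_bigr => i _; rewrite complex_scaleA //; exact: Te.
rewrite exchange_big; apply: eq_bigr => i _ /=.
by rewrite mxE complex_scale_suml; apply: eq_bigr => k _; rewrite mulrC.
Qed.

Lemma transition1 e q : transition e e q 1%:M.
Proof.
move=> j; rewrite (bigD1 j) //= big1 => [|k kj].
  by rewrite mxE eqxx complex_scale1 addr0.
by rewrite mxE (negPf kj) complex_scale0.
Qed.

Lemma transition_uniq D e s q g h : D q -> complex_frame_on T J D e ->
  (forall j, T q (s j q)) -> transition e s q g -> transition e s q h -> g = h.
Proof.
move=> Dq [_ _ Fe] Ts sg sh; apply/matrixP => k j.
have [z [_ zU]] := Fe q (s j q) Dq (Ts j).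
have gz : z = col j g.
  by apply: zU; rewrite sg; apply: eq_bigr => i _; rewrite mxE.
have hz : z = col j h.
  by apply: zU; rewrite sh; apply: eq_bigr => i _; rewrite mxE.
by have := congr1 (fun u : 'cV_n => u k 0) (etrans (esym gz) hz); rewrite !mxE.
Qed.

Lemma transition_exists D e s q : D q -> complex_frame_on T J D e ->
  (forall j, T q (s j q)) -> exists h, transition e s q h.
Proof.
move=> Dq [_ _ Fe] Ts.
have /choice[z zE] : forall j, exists z : 'cV[R[i]]_n,
    s j q = \sum_k scale q (z k 0) (e k q).
  by move=> j; have [z [zE _]] := Fe q (s j q) Dq (Ts j); exists z.
exists (\matrix_(k, j) z j k 0) => j; rewrite zE.
by apply: eq_bigr => k _; rewrite mxE.
Qed.

(** Expanding [e] back in [s] yields a right inverse of [h], by uniqueness of coefficients. *)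
Lemma transition_det_neq0 D e s q h : D `<=` S -> D q ->
  complex_frame_on T J D e -> complex_frame_on T J D s ->
  transition e s q h -> \det h != 0.
Proof.
move=> DS Dq Fe Fs es.
have Te : forall j, T q (e j q) by case: Fe => _ + _ j; apply.
have [g se] := transition_exists Dq Fs Te.
have hg1 : h *m g = 1%:M.
  by apply: (transition_uniq Dq Fe Te) => //;
    [exact: (transitionM DS Dq Fe es se) | exact: transition1].
apply/negP => /eqP h0; have := congr1 determinant hg1.
by rewrite det_mulmx h0 mul0r det1 => /esym/eqP; rewrite oner_eq0.
Qed.

Lemma complex_frame_onW D D' (s : 'I_n -> B -> E) : D' `<=` D ->
  complex_frame_on T J D s -> complex_frame_on T J D' s.
Proof.
move=> DD [sc sT sU]; split=> [k|k q /DD|q v /DD].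
- exact: continuous_subspaceW (sc k).
- exact: sT.
- exact: sU.
Qed.

Variables (e : 'I_n -> B -> E) (coef : 'I_n -> B -> E -> R[i]).
Hypothesis Fe : complex_frame_on T J S e.
Hypothesis coefE : forall q v, S q -> T q v ->
  v = \sum_k scale q (coef k q v) (e k q).
Hypothesis coef_continuous : forall (D : set B) s k, D `<=` S ->
  {within D, continuous s} -> continuousC_on D (fun q => coef k q (s q)).

Lemma zero_chern_cocycle : chern_cocycle n T J (zero_cocycle2 S).
Proof.
exists (fun=> e), (fun _ _ _ => 1%:M), (fun _ _ _ => 0); split=> //=.
- by move=> x Sx; rewrite setTI.
- by move=> x y _ _ q _ j; exact: transition1.
- by move=> x y _ _; exact: continuousC_on_cst.
- by move=> x y _ _ q _; rewrite mulr0 cexp0 det1.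
- by move=> x y z _ _ _ q _; rewrite subrr addr0.
Qed.

(* The transition determinants are coboundaries of the determinants of the
   local frames with respect to the global one; a logarithm of the latter on
   smaller neighbourhoods differs from the given one by an integral cochain. *)
Lemma chern_cocycle_cohomologous_zero d :
  chern_cocycle n T J d -> cohomologous (zero_cocycle2 S) d.
Proof.
move=> [s [g [f [Fs sg fc fE dE]]]].
pose h x q : 'M[R[i]]_n := \matrix_(k, j) coef k q (s x j q).
pose D x := cocover d x `&` S.
have DS x : D x `<=` S by move=> q [].
have Dx x : S x -> D x x by move=> Sx; split=> //; exact: nbhd_mem.
have FeD x : complex_frame_on T J (D x) e by exact: complex_frame_onW Fe.
have hE x q : S x -> D x q -> transition e (s x) q (h x q).
  move=> Sx Dq j; have [_ sT _] := Fs x Sx.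
  rewrite [LHS](coefE (DS _ _ Dq) (sT j q Dq)).
  by apply: eq_bigr => k _; rewrite mxE.
have hc x : S x -> continuousC_on (D x) (fun q => \det (h x q)).
  move=> Sx; apply: continuousC_on_det => k j; have [sc _ _] := Fs x Sx.
  have -> : (fun q => h x q k j) = (fun q => coef k q (s x j q)).
    by apply/funext => q; rewrite mxE.
  exact: coef_continuous.
(* A neighbourhood and a logarithm of [\det (h x)] are chosen at each point; the values off S are
   dummies. *)
have /choice[Wl WlP] : forall x, exists Wl : set B * (B -> R[i]), S x ->
    [/\ open Wl.1, Wl.1 x, continuousC_on (Wl.1 `&` D x) Wl.2 &
      forall q, (Wl.1 `&` D x) q ->
        cexp ((0 +i* (2 * pi)) * Wl.2 q) = \det (h x q)].
  move=> x; have [Sx|nSx] := pselect (S x); last by exists (setT, fun=> 0).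
  have h0 : \det (h x x) != 0.
    apply: (transition_det_neq0 (@DS x) (Dx x Sx) (FeD x) (Fs x Sx)).
    exact/hE/Dx.
  have [N [l [oN Nx lc lE]]] := local_clog (Dx x Sx) h0 (hc x Sx).
  by exists (N, l).
pose W x := (Wl x).1 `&` cocover d x; pose l x := (Wl x).2.
have oW x : S x -> open (W x).
  by move=> Sx; apply: openI; [have [] := WlP x Sx | exact: nbhd_open].
have mW x : S x -> W x x.
  by move=> Sx; split; [have [] := WlP x Sx | exact: nbhd_mem].
(* [f] minus the coboundary of [l]: it has the same coboundary as [f], and it is integral because
   det h_y = det h_x det g_xy. *)
pose phi x y q := f x y q - l y q + l x q.
have WD x q : W x q -> S q -> ((Wl x).1 `&` D x) q by move=> [? ?] ?.
have phic x y : S x -> S y -> continuousC_on (W x `&` W y `&` S) (phi x y).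
  move=> Sx Sy; have [_ _ lcx _] := WlP x Sx; have [_ _ lcy _] := WlP y Sy.
  apply: continuousC_onD.
    apply: continuousC_onB.
      by apply: continuousC_onW (fc x y Sx Sy) => q [[[_ ?] [_ ?]] ?].
    by apply: continuousC_onW lcy => q [[_ ?] ?]; exact: WD.
  by apply: continuousC_onW lcx => q [[? _] ?]; exact: WD.
have phi_int x y q : S x -> S y -> (W x `&` W y `&` S) q ->
    exists m : int, phi x y q = m%:~R.
  move=> Sx Sy [[Wx Wy] Sq].
  have [_ _ _ lx] := WlP x Sx; have [_ _ _ ly] := WlP y Sy.
  have [Dxq Dyq] : D x q /\ D y q by split; split=> //; [case: Wx | case: Wy].
  have Uq : (cocover d x `&` cocover d y `&` S) q.
    by case: Dxq Dyq => ? ? [? ?].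
  apply: cexp_eq1; have := ly q (WD _ _ Wy Sq); have := lx q (WD _ _ Wx Sq).
  have := fE x y Sx Sy q Uq; rewrite /phi -/(l x q) -/(l y q).
  move: (0 +i* (2 * pi)) => k; rewrite mulrDr mulrBr !cexpD => fk -> lyE.
  have hg : h y q = h x q *m g x y q.
    have [_ sT _] := Fs y Sy.
    apply: (transition_uniq Dxq (FeD x) (s := s y)).
    - by move=> j; exact: sT.
    - exact: hE.
    - apply: (transitionM (@DS x) Dxq (FeD x)); first exact: hE.
      by move=> j; exact: sg.
  rewrite fk mulrAC [_ * \det (h x q)]mulrC -det_mulmx -hg -lyE.
  by rewrite mulrC cexpN.
pose b x y q : int := Num.floor (complex.Re (phi x y q)).
have bE x y q : S x -> S y -> (W x `&` W y `&` S) q -> phi x y q = (b x y q)%:~R.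
  move=> Sx Sy Wq; have [m mE] := phi_int x y q Sx Sy Wq.
  rewrite /b mE; congr (_%:~R).
  by rewrite -(rmorph_int (real_complex R)) /= intrKfloor.
(* The sign comes from comparing 0 with [d], in that order: the difference is minus the coboundary
   of [phi]. *)
exists (PointCover oW mW), (fun x y q => - b x y q); split=> /=.
- by move=> x Sx q [? ?].
- move=> x y Sx Sy; apply: locally_constantN.
  by apply: integral_locally_constant (phic x y Sx Sy) _ => q; exact: bE.
- move=> x y z Sx Sy Sz q [[[Wx Wy] Wz] Sq].
  apply: (@intr_inj R[i]); rewrite !(intrD, intrB, mulrNz) -!bE //.
  rewrite /phi dE //; last by case: Wx Wy Wz => ? ? [? ?] [? ?].
  by ring.
Qed.

Lemma first_chern_class_eq0 : first_chern_class S n T J = H2_zero S.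
Proof.
apply/seteqP; split=> c /=.
  move=> [d dc]; apply: cohomologous_trans.
  exact: chern_cocycle_cohomologous_zero.
by move=> zc; exists (zero_cocycle2 S) => //; exact: zero_chern_cocycle.
Qed.

End GlobalFrame.

(** * The tangent bundle of the product as a complex vector bundle *)

Section ProductBundle.
Context {R : realType} (P : 'I_2 -> 'M[R]_8).
Hypothesis hP : symmetric_clifford_system P.
Variables U W : 'M[R]_(8, 4).
Hypotheses (P0U : P 0 *m U = U) (P1U : P 1 *m U = W) (UU : U^T *m U = 1%:M).
Variable J : @ambient R -> @ambient R -> @ambient R.
Hypothesis hJ : product_complex_structure P J.

Local Notation M := (circle_focal P).
Local Notation T := (tangent_space M).
Local Notation e := (focal_frame P U W).

Lemma tangent0 p : M p -> T p 0.
Proof.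
case: p => a x Mp; apply/(tangent_circle_focalE hP 0 Mp); split.
  by exists 0; rewrite scale0r.
by split; rewrite dotC dot0l.
Qed.

Lemma tangent_lin p (c : R) v w : M p -> T p v -> T p w -> T p (c *: v + w).
Proof.
case: p => a x Mp /(tangent_circle_focalE hP v Mp)[[k vE] [v0 v1 v2]].
move=> /(tangent_circle_focalE hP w Mp)[[l wE] [w0 w1 w2]].
apply/(tangent_circle_focalE hP _ Mp); split.
  by exists (c * k + l); rewrite /= vE wE scalerDl scalerA.
by split; rewrite /= dotDr dotZr ?v0 ?v1 ?v2 ?w0 ?w1 ?w2 mulr0 addr0.
Qed.

Lemma J_lin p (c : R) v w : M p -> T p v -> T p w ->
  J p (c *: v + w) = c *: J p v + J p w.
Proof. by case: p => a x Mp; have [+ _ _ _] := hJ Mp; exact. Qed.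

Lemma tangent_scale p (c : R) v : M p -> T p v -> T p (c *: v).
Proof.
move=> Mp Tv; rewrite -[_ *: _]addr0; apply: tangent_lin => //.
exact: tangent0.
Qed.

Lemma J_sum p (I : Type) (r : seq I) (c : I -> R) (v : I -> @ambient R) : M p ->
  (forall i, T p (v i)) ->
  J p (\sum_(i <- r) c i *: v i) = \sum_(i <- r) c i *: J p (v i).
Proof.
move=> Mp Tv; elim: r => [|i r IH].
  by rewrite !big_nil (J_zero tangent0 J_lin Mp).
rewrite !big_cons J_lin ?IH //.
by apply: (T_sum tangent0 tangent_lin) => // j; exact: tangent_scale.
Qed.

(** [J] permutes the frame vectors up to sign, so the claim follows by expanding [v] in the
    frame. *)
Lemma tangent_J p v : M p -> T p v -> T p (J p v).
Proof.
move=> Mp Tv; have Te i := focal_frame_tangent hP P0U P1U UU i Mp.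
rewrite (focal_frame_expand hP P0U P1U UU Mp Tv) J_sum //.
apply: (T_sum tangent0 tangent_lin) => // i; apply: tangent_scale => //.
case: (split_ordP i) => k ->; have [h1 h2] := J_focal_frame hP P0U P1U UU hJ k Mp.
  by rewrite h1.
by rewrite h2 -scaleN1r; exact: tangent_scale.
Qed.

Lemma J_J p v : M p -> T p v -> J p (J p v) = - v.
Proof.
move=> Mp Tv; have Te i := focal_frame_tangent hP P0U P1U UU i Mp.
rewrite (focal_frame_expand hP P0U P1U UU Mp Tv) J_sum //.
rewrite J_sum //; last by move=> i; exact: tangent_J.
rewrite -sumrN.
apply: eq_bigr => i _; rewrite -scalerN; congr (_ *: _).
case: (split_ordP i) => k ->; have [h1 h2] := J_focal_frame hP P0U P1U UU hJ k Mp.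
  by rewrite h1 h2.
have := J_lin (-1) Mp (Te (lshift 3 k)) (tangent0 Mp).
by rewrite (J_zero tangent0 J_lin Mp) !addr0 !scaleN1r h1 h2.
Qed.

(** Since the second half of the frame is J of the first, the real coordinates along e_k and J e_k
    are the real and imaginary parts of one complex coordinate. *)
Definition focal_coef (k : 'I_3) (p v : @ambient R) : R[i] :=
  ambient_dot v (e (lshift 3 k) p) +i* ambient_dot v (e (rshift 3 k) p).

Lemma complex_scale_frame p z k : M p ->
  complex_scale J p z (e (lshift 3 k) p) =
    complex.Re z *: e (lshift 3 k) p + complex.Im z *: e (rshift 3 k) p.
Proof.
by move=> Mp; rewrite /complex_scale (J_focal_frame hP P0U P1U UU hJ k Mp).1.
Qed.

(** Turns complex combinations of three vectors into real ones of six, carrying existence and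
    uniqueness of coordinates over from the orthonormal frame. *)
Lemma sum_complex_scale_frame p (z : 'I_3 -> R[i]) : M p ->
  \sum_k complex_scale J p (z k) (e (lshift 3 k) p) =
  \sum_(i < 3 + 3) (match fintype.split i with
                   | inl k => complex.Re (z k)
                   | inr k => complex.Im (z k)
                   end) *: e i p.
Proof.
move=> Mp; rewrite big_split_ord -[RHS]big_split; apply: eq_bigr => k _ /=.
rewrite complex_scale_frame //.
by rewrite (unsplitK (inl k)) (unsplitK (inr k)).
Qed.

Lemma focal_coefE p v : M p -> T p v ->
  v = \sum_k complex_scale J p (focal_coef k p v) (e (lshift 3 k) p).
Proof.
move=> Mp Tv; rewrite sum_complex_scale_frame //.
rewrite [LHS](focal_frame_expand hP P0U P1U UU Mp Tv); apply: eq_bigr => i _.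
by case: (split_ordP i) => k ->; rewrite ?(unsplitK (inl k)) ?(unsplitK (inr k)).
Qed.

Lemma focal_complex_frame : complex_frame_on T J M (fun k : 'I_3 => e (lshift 3 k)).
Proof.
split.
- move=> k; apply: continuous_subspaceT.
  exact/smooth_continuous/focal_frame_smooth.
- by move=> k p Mp; exact: focal_frame_tangent.
- move=> p v Mp Tv; exists (\col_k focal_coef k p v); split.
    rewrite {1}(focal_coefE Mp Tv); by apply: eq_bigr => k _; rewrite mxE.
  move=> z vE; apply/colP => k; rewrite mxE.
  rewrite sum_complex_scale_frame // in vE.
  rewrite /focal_coef vE !(focal_frame_coord hP P0U P1U UU) //.
  rewrite (unsplitK (inl k)) (unsplitK (inr k)).
  by case: (z k 0).
Qed.

Lemma continuous_ambient_dot (D : set (@ambient R))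
  (f g : @ambient R -> @ambient R) :
  {within D, continuous f} -> {within D, continuous g} ->
  {within D, continuous (fun p => ambient_dot (f p) (g p))}.
Proof.
move=> fc gc p.
have sm : smooth_on setT
    (fun z : (@ambient R * @ambient R)%type => ambient_dot z.1 z.2).
  have s1 : smooth_on setT (fun z : (@ambient R * @ambient R)%type => z.1).
    exact/smooth_fst/smooth_id.
  have s2 : smooth_on setT (fun z : (@ambient R * @ambient R)%type => z.2).
    exact/smooth_snd/smooth_id.
  apply: smooth_add; last by apply: smooth_dot; exact: smooth_snd.
  apply: smooth_add; apply: smooth_mul.
  - exact/smooth_fst/smooth_fst.
  - exact/smooth_fst/smooth_fst.
  - exact/smooth_snd/smooth_fst.
  - exact/smooth_snd/smooth_fst.
have c : continuous_at (f p, g p) (fun z => ambient_dot z.1 z.2).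
  exact: smooth_continuous.
exact: (cvg_comp (fun q => (f q, g q)) _ (cvg_pair (fc p) (gc p)) c).
Qed.

Lemma focal_coef_continuous (D : set (@ambient R)) s k : D `<=` M ->
  {within D, continuous s} -> continuousC_on D (fun q => focal_coef k q (s q)).
Proof.
move=> DM sc; split=> /=; apply: continuous_ambient_dot => //;
  by apply: continuous_subspaceT; exact/smooth_continuous/focal_frame_smooth.
Qed.

End ProductBundle.

Theorem proposition2 (R : realType) (P : 'I_2 -> 'M[R]_8)
    (J : @ambient R -> @ambient R -> @ambient R)
    (hP : symmetric_clifford_system P)
    (hJ : product_complex_structure P J) :
  (exists e : 'I_(3 + 3) -> @ambient R -> @ambient R,
     U_frame P J e /\ orthonormal_frame P e) /\
  first_chern_class (circle_focal P) 3
    (tangent_space (circle_focal P)) J = H2_zero (circle_focal P).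
Proof.
have [U [P0U UU]] := clifford_basis hP.
split; first by exists (focal_frame P U (P 1 *m U)); exact: focal_U_frame.
(* The first half of the U-frame is the global complex frame; its coordinates are inner products,
   hence continuous along continuous sections. *)
apply: (first_chern_class_eq0 (tangent0 hP) (tangent_lin hP)
  (tangent_J hP P0U erefl UU hJ) (J_lin hJ) (J_J hP P0U erefl UU hJ)
  (focal_complex_frame hP P0U erefl UU hJ)).
  exact: focal_coefE.
exact: focal_coef_continuous.
Qed.
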